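(* Let $f\colon[0,1)\to\mathbb{R}_{\ge0}$ be Riemann integrable, let $\alpha\in\mathbb{R}^+$, let $(f_i)_{i\in\mathbb{N}}$ be non-negative Riemann integrable functions on $[0,1)$ converging uniformly to $f$, and let $(\alpha_i)_{i\in\mathbb{N}}$ be a sequence in $\mathbb{R}^+$ with $\alpha_i\to\alpha$ and $\alpha_i\ne\alpha$ for all $i$. Let $(y_i)_{i\in\mathbb{N}}$ be any sequence in $[0,1)$ and let $\mu_{y_i}=\sum_{z\in\mathbb{Z}}f_i(T_{\alpha_i}^z(y_i))\,\delta_z$ be the $f_i$-weighted return time measure with respect to $T_{\alpha_i}$ with reference point $y_i$. Then each $\gamma_{\mu_{y_i}}$ exists, the sequence $(\gamma_{\mu_{y_i}})_{i\in\mathbb{N}}$ converges vaguely to $$\gamma=\sum_{z\in\mathbb{Z}}\Xi(T_\alpha,\Lambda)(z)\,\delta_z,$$ and $$\widehat{\gamma}=\sum_{m\in\mathbb{Z}}\big|\widehat{f_\iota}(m)\big|^2\,\delta_{e^{2\pi i\alpha m}},\qquad \widehat{f_\iota}(m)=\int_0^1 f(t)e^{-2\pi i m t}\,dt .$$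
   Context: $T_\beta(x)=\{x+\beta\}$ on $[0,1)$ with $\{t\}$ the fractional part; $\Lambda$ is Lebesgue measure on $[0,1)$; $\Xi(T_\alpha,\Lambda)(z)=\int_0^1 f(T_\alpha^{-z}x)f(x)\,dx$. For a measure $\mu$ on $\mathbb{Z}$, $\widetilde{\mu}(A)=\overline{\mu(-A)}$, $\mu|_n$ is the restriction to $\{|x|\le n\}$, and the autocorrelation $\gamma_\mu$ is the vague limit of $\frac1{2n+1}\mu|_n*\widetilde{\mu|_n}$; vague convergence on $\mathbb{Z}$ means convergence of the mass at each point. $\mathbb{T}$ is the unit circle with normalised Haar measure $\omega_{\mathbb{T}}$, paired with $\mathbb{Z}$ by $(x,z)=x^z$. The diffraction $\widehat{\gamma}$ of a positive definite translation bounded measure $\gamma$ on $\mathbb{Z}$ is the unique measure on $\mathbb{T}$ with $\int\widehat{\varphi}\,d\gamma=\int\varphi\,d\widehat{\gamma}$ for all $\varphi=l*\widetilde{l}$, $l\in C(\mathbb{T})$, where $\widehat{\varphi}(z)=\int_{\mathbb{T}}\varphi(x)\overline{x^z}\,d\omega_{\mathbb{T}}(x)$ and $\widetilde{l}(x)=\overline{l(x^{-1})}$. *)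

(* Defs.v *)
From Stdlib Require Import Reals Lra ZArith ClassicalEpsilon.
Open Scope R_scope.

Definition rot (beta : R) (z : Z) (x : R) : R := frac_part (x + IZR z * beta).

(** Riemann integral as a relation, and a totalised version (junk value if
    the function is not Riemann integrable on [a,b]). *)
Definition is_RInt (g : R -> R) (a b v : R) : Prop :=
  exists pr : Riemann_integrable g a b, RiemannInt pr = v.
Definition Rint (g : R -> R) (a b : R) : R :=
  epsilon (inhabits 0) (fun v => is_RInt g a b v).

Definition sumZ (g : Z -> R) (N : nat) : R :=
  sum_f_R0 (fun k => g (Z.of_nat k - Z.of_nat N)%Z) (2 * N).

Definition return_weights (fi : R -> R) (beta y : R) (z : Z) : R :=
  fi (rot beta z y).

(** Mass at z of (1/(2n+1)) mu|_n * ~(mu|_n), for a real measure w on Z: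
    sum over a with |a|<=n, |a-z|<=n of w(a) w(a-z). *)
Definition autocorr_approx (w : Z -> R) (n : nat) (z : Z) : R :=
  / INR (2 * n + 1) *
  sumZ (fun a => if (Z.abs (a - z) <=? Z.of_nat n)%Z then w a * w (a - z)%Z else 0) n.

(** g is the autocorrelation of w (vague limit = pointwise limit of masses). *)
Definition is_autocorrelation (w : Z -> R) (g : Z -> R) : Prop :=
  forall z, Un_cv (fun n => autocorr_approx w n z) (g z).

Definition vague_cv (gs : nat -> Z -> R) (g : Z -> R) : Prop :=
  forall z, Un_cv (fun i => gs i z) (g z).

Definition Xi (f : R -> R) (alpha : R) (z : Z) : R :=
  Rint (fun x => f (rot alpha (- z) x) * f x) 0 1.

Definition fhat_re (f : R -> R) (m : Z) : R :=
  Rint (fun t => f t * cos (2 * PI * IZR m * t)) 0 1.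
Definition fhat_im (f : R -> R) (m : Z) : R :=
  - Rint (fun t => f t * sin (2 * PI * IZR m * t)) 0 1.
Definition fhat_sqnorm (f : R -> R) (m : Z) : R :=
  fhat_re f m ^ 2 + fhat_im f m ^ 2.

(** The circle T is parametrised by t in [0,1) via t |-> e^{2 pi i t}; Haar
    measure becomes Lebesgue measure on [0,1).  A function l in C(T) is given by
    its real and imaginary parts, continuous and 1-periodic on R. *)
Definition circle_cont (lr li : R -> R) : Prop :=
  continuity lr /\ continuity li /\ (forall t, lr (t + 1) = lr t /\ li (t + 1) = li t).

(** phi = l * ~l, i.e. phi(s) = int_T l(y) ~l(y^{-1} x) dy
    = int_0^1 l(t) conj(l(t - s)) dt  (x = e^{2 pi i s}). *)
Definition conv_re (lr li : R -> R) (s : R) : R :=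
  Rint (fun t => lr t * lr (t - s) + li t * li (t - s)) 0 1.
Definition conv_im (lr li : R -> R) (s : R) : R :=
  Rint (fun t => li t * lr (t - s) - lr t * li (t - s)) 0 1.

(** phi^(z) = int_T phi(x) conj(x^z) dx = int_0^1 phi(s) e^{-2 pi i z s} ds. *)
Definition convhat_re (lr li : R -> R) (z : Z) : R :=
  Rint (fun s => conv_re lr li s * cos (2 * PI * IZR z * s)
               + conv_im lr li s * sin (2 * PI * IZR z * s)) 0 1.
Definition convhat_im (lr li : R -> R) (z : Z) : R :=
  Rint (fun s => conv_im lr li s * cos (2 * PI * IZR z * s)
               - conv_re lr li s * sin (2 * PI * IZR z * s)) 0 1.

(** "The diffraction of the measure gam on Z is the pure point measure
    sum_m c(m) delta_{e^{2 pi i theta(m)}} on T":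
    gam is translation bounded, the pure point measure is a finite positive
    measure, and the defining identity  int phi^ d gam = int phi d gam^
    holds (both sides absolutely convergent) for all phi = l * ~l, l in C(T). *)
Definition is_pp_diffraction (gam : Z -> R) (c : Z -> R) (theta : Z -> R) : Prop :=
  (exists B, forall z, Rabs (gam z) <= B) /\
  (forall m, 0 <= c m) /\
  (exists B, forall N, sumZ c N <= B) /\
  forall lr li : R -> R, circle_cont lr li ->
    (exists B, forall N,
        sumZ (fun z => (Rabs (convhat_re lr li z) + Rabs (convhat_im lr li z))
                       * Rabs (gam z)) N <= B) /\
    exists Lr Li : R,
      Un_cv (sumZ (fun z => convhat_re lr li z * gam z)) Lr /\
      Un_cv (sumZ (fun z => convhat_im lr li z * gam z)) Li /\
      Un_cv (sumZ (fun m => c m * conv_re lr li (theta m))) Lr /\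
      Un_cv (sumZ (fun m => c m * conv_im lr li (theta m))) Li.

(* Main.v *)
From Stdlib Require Import Reals RList ZArith Lra Lia ClassicalEpsilon.
From Coquelicot Require Import Coquelicot.
Require Import Defs.
Open Scope R_scope.

(** A 1-periodic Riemann integrable function [F] is squeezed, uniformly, between trigonometric
    polynomials: [|F - P| <= H] with [mean H] small (Fejer means of [F] and of its oscillation on a
    fine partition). Along an orbit of the rotation by [beta], a trigonometric polynomial of degree
    at most [D] averages to its mean as soon as [m beta] is not an integer for [0 < |m| <= D]. Since
    [alpha_i -> alpha] and [alpha_i <> alpha], this non-resonance holds for every fixed [D] and all
    large [i], also when [alpha_i] is rational; hence the autocorrelations converge to
    [z |-> int F(x) F(x - z alpha) dx]. (When [alpha_i] is rational the weights are periodic, so the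
    autocorrelation exists anyway.)

    The same squeeze gives mean-square convergence of Fourier series and so the expansion
    [int g(t) h(t - s) dt = sum_m g^(m) conj(h^(m)) exp(2 pi i m s)], uniformly in [s]. Applied to
    [f] and to [l], it turns both sides of the identity defining the diffraction into the absolutely
    convergent double sum of [|l^(z)|^2 |f^(m)|^2 exp(2 pi i z m alpha)]. *)

(** * Finite sums and means of periodic functions *)

(** A Riemann integrable function need not be a uniform limit of trigonometric polynomials, so the
    error is bounded by a second trigonometric polynomial [H] instead of a number. Orbit averages of
    [H] then obey the same non-resonance rule as those of [P], and the smallness of [mean H] passes
    to sums along the orbit from every starting point.

    The order of choices is what lets the two limits be combined: the degree [D] and the tolerance
    [d] depend only on the limit function, on [z] and on the accuracy, while the number of terms may
    depend on [i].

    The condition [alphas i <> alpha] is used near resonances: two distinct numbers whose [m]-th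
    multiples are both integers are at least [1 / |m|] apart, so a resonance at [alpha] itself
    excludes one close by. For rational [alpha] the orbit averages along [alpha] itself may depend
    on the reference point.

    Everything is real-valued: a phase inside the cosine replaces the complex exponential, and
    complex coefficients are carried as pairs. *)

Fixpoint rsum (u : nat -> R) (n : nat) : R :=
  match n with O => 0 | S k => rsum u k + u k end.

Lemma rsum_ext u v n : (forall k, (k < n)%nat -> u k = v k) -> rsum u n = rsum v n.
Proof.
  induction n as [|n IH]; intros H; simpl; [reflexivity|].
  rewrite IH by (intros; apply H; lia). rewrite H by lia. reflexivity.
Qed.

Lemma rsum_le u v n : (forall k, (k < n)%nat -> u k <= v k) -> rsum u n <= rsum v n.
Proof.
  induction n as [|n IH]; intros H; simpl; [lra|].
  apply Rplus_le_compat; [apply IH; intros; apply H|apply H]; lia.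
Qed.

Lemma rsum_plus u v n : rsum (fun k => u k + v k) n = rsum u n + rsum v n.
Proof. induction n; simpl; lra. Qed.

Lemma rsum_minus u v n : rsum (fun k => u k - v k) n = rsum u n - rsum v n.
Proof. induction n; simpl; lra. Qed.

Lemma rsum_scal c u n : rsum (fun k => c * u k) n = c * rsum u n.
Proof. induction n as [|n IH]; simpl; [|rewrite IH]; ring. Qed.

Lemma rsum_const c n : rsum (fun _ => c) n = INR n * c.
Proof. induction n as [|n IH]; [simpl; ring|]. rewrite S_INR. simpl. rewrite IH. ring. Qed.

Lemma rsum_abs u n : Rabs (rsum u n) <= rsum (fun k => Rabs (u k)) n.
Proof.
  induction n; simpl; [rewrite Rabs_R0; lra|].
  eapply Rle_trans; [apply Rabs_triang|lra].
Qed.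

Lemma rsum_nonneg u n : (forall k, (k < n)%nat -> 0 <= u k) -> 0 <= rsum u n.
Proof.
  intros H. rewrite <- (Rmult_0_r (INR n)), <- rsum_const. now apply rsum_le.
Qed.

Lemma rsum_app u n m : rsum u (n + m) = rsum u n + rsum (fun k => u (n + k)%nat) m.
Proof.
  induction m as [|m IH]; simpl; [rewrite Nat.add_0_r; ring|].
  rewrite Nat.add_succ_r. simpl. rewrite IH. ring.
Qed.

Lemma rsum_first u n : rsum u (S n) = u 0%nat + rsum (fun k => u (S k)) n.
Proof. replace (S n) with (1 + n)%nat by lia. rewrite rsum_app. simpl. ring. Qed.

Lemma rsum_swap (u : nat -> nat -> R) n m :
  rsum (fun i => rsum (u i) m) n = rsum (fun j => rsum (fun i => u i j) n) m.
Proof.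
  induction n as [|n IH]; simpl.
  - rewrite rsum_const. ring.
  - rewrite IH, <- rsum_plus. reflexivity.
Qed.

Lemma rsum_mult u v n m :
  rsum u n * rsum v m = rsum (fun i => rsum (fun j => u i * v j) m) n.
Proof.
  induction n as [|n IH]; simpl; [ring|].
  rewrite <- IH, rsum_scal. ring.
Qed.

Lemma rsum_pick (u : nat -> R) n j : (j < n)%nat ->
  rsum (fun k => if Nat.eqb k j then u k else 0) n = u j.
Proof.
  induction n as [|n IH]; intros Hj; [lia|]. simpl.
  destruct (Nat.eqb_spec n j) as [->|Hne].
  - rewrite (rsum_ext _ (fun _ => 0)); [rewrite rsum_const; ring|].
    intros k Hk. destruct (Nat.eqb_spec k j); [lia|reflexivity].
  - rewrite IH by lia. ring.
Qed.

Lemma rsum_blocks (v : nat -> R) n r : (0 < r)%nat ->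
  rsum (fun i => v (i / r)%nat) (n * r) = INR r * rsum v n.
Proof.
  intros Hr. induction n as [|n IH]; simpl; [ring|].
  rewrite Nat.add_comm, rsum_app, IH.
  rewrite (rsum_ext (fun k => v ((n * r + k) / r)%nat) (fun _ => v n)).
  - rewrite rsum_const. ring.
  - intros k Hk. f_equal. rewrite Nat.div_add_l by lia. rewrite Nat.div_small by lia. lia.
Qed.

(** * Riemann integrability of products *)

Lemma stepfun_comp (h : R -> R) a b (f : StepFun a b) : IsStepFun (fun x => h (f x)) a b.
Proof.
  exists (subdivision f). exists (List.map h (subdivision_val f)).
  destruct (StepFun_P1 f) as (H1 & H2 & H3 & H4 & H5).
  repeat split; try assumption.
  - rewrite List.length_map. exact H4.
  - intros i Hi x Hx. rewrite (H5 i Hi x Hx).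
    rewrite RList_P12; [reflexivity|]. rewrite H4 in Hi. exact Hi.
Qed.

(** Integrability provides a step function [phi] with error below a step function [psi] of small
    integral. Then [h] composed with [phi] is a step function on the same subdivision, with error
    below [L * psi]. *)
Lemma ex_RInt_comp_lipschitz (h f : R -> R) (L a b : R) :
  0 < L -> (forall x y, Rabs (h x - h y) <= L * Rabs (x - y)) ->
  ex_RInt f a b -> ex_RInt (fun x => h (f x)) a b.
Proof.
  intros HL Hh Hf. apply ex_RInt_Reals_1. apply ex_RInt_Reals_0 in Hf.
  intros eps.
  destruct (Hf (mkposreal (eps / L) (Rdiv_lt_0_compat _ _ (cond_pos eps) HL)))
    as (phi & psi & H1 & H2).
  exists (mkStepFun (stepfun_comp h a b phi)).
  exists (mkStepFun (StepFun_P28 L (mkStepFun (StepFun_P4 a b 0)) psi)).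
  split.
  - intros t Ht. simpl. unfold fct_cte. specialize (H1 t Ht).
    eapply Rle_trans; [apply Hh|]. rewrite Rplus_0_l. nra.
  - rewrite StepFun_P30, StepFun_P18, Rmult_0_l, Rplus_0_l, Rabs_mult, (Rabs_pos_eq L) by lra.
    simpl in H2. apply (Rmult_lt_compat_l L) in H2; [|exact HL].
    replace (L * (eps / L)) with (pos eps) in H2 by (field; lra). exact H2.
Qed.

(** The square is not globally Lipschitz. Clipping to [-B, B] makes it so, and changes nothing on a
    function bounded by [B]. *)
Lemma clip_square_lipschitz (B x y : R) : 0 < B ->
  Rabs (Rmax (- B) (Rmin B x) ^ 2 - Rmax (- B) (Rmin B y) ^ 2) <= 2 * B * Rabs (x - y).
Proof.
  intros HB.
  set (u := Rmax (- B) (Rmin B x)). set (v := Rmax (- B) (Rmin B y)).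
  assert (Hu : Rabs (u + v) <= 2 * B).
  { apply Rabs_le. unfold u, v, Rmax, Rmin.
    repeat destruct (Rle_dec _ _); lra. }
  assert (Hv : Rabs (u - v) <= Rabs (x - y)).
  { unfold u, v, Rmax, Rmin.
    repeat destruct (Rle_dec _ _); unfold Rabs; repeat destruct (Rcase_abs _); lra. }
  replace (u ^ 2 - v ^ 2) with ((u + v) * (u - v)) by ring.
  rewrite Rabs_mult. apply Rmult_le_compat; auto using Rabs_pos.
Qed.

Lemma ex_RInt_square (f : R -> R) a b :
  ex_RInt f a b -> ex_RInt (fun x => f x ^ 2) a b.
Proof.
  intros Hf. destruct (ex_RInt_ub f a b Hf) as [M HM].
  set (B := Rabs M + 1).
  assert (HB : 0 < B) by (unfold B; generalize (Rabs_pos M); lra).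
  apply ex_RInt_ext with (fun x => (fun y => Rmax (- B) (Rmin B y) ^ 2) (f x)).
  - intros x Hx. f_equal.
    assert (Hb : Rabs (f x) <= B).
    { apply Rle_trans with M; [apply HM; lra|]. unfold B. generalize (Rle_abs M); lra. }
    apply Rabs_le_between in Hb. rewrite Rmin_right, Rmax_right by lra. reflexivity.
  - apply (ex_RInt_comp_lipschitz (fun y => Rmax (- B) (Rmin B y) ^ 2) f (2 * B)); [lra| |exact Hf].
    intros x y. now apply clip_square_lipschitz.
Qed.

Lemma ex_RInt_mult (f g : R -> R) a b :
  ex_RInt f a b -> ex_RInt g a b -> ex_RInt (fun x => f x * g x) a b.
Proof.
  intros Hf Hg.
  (* Polarization: a product is a quarter of the difference of the squares of the sum and the
     difference. *)
  apply ex_RInt_ext with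
    (fun x => scal (/ 4) (minus (plus (f x) (g x) ^ 2) (minus (f x) (g x) ^ 2))).
  - intros x _. unfold scal, minus, plus, opp; simpl. unfold mult; simpl. field.
  - apply (ex_RInt_scal (V := R_NormedModule)), (ex_RInt_minus (V := R_NormedModule));
      apply ex_RInt_square.
    + now apply (ex_RInt_plus (V := R_NormedModule)).
    + now apply (ex_RInt_minus (V := R_NormedModule)).
Qed.

(** * Means of 1-periodic Riemann integrable functions *)

Definition pri (g : R -> R) : Prop := (forall x, g (x + 1) = g x) /\ ex_RInt g 0 1.

Definition mean (g : R -> R) : R := RInt g 0 1.

Lemma per_IZR (g : R -> R) : (forall x, g (x + 1) = g x) ->
  forall (k : Z) x, g (x + IZR k) = g x.
Proof.
  intros Hg.
  assert (Hn : forall (n : nat) x, g (x + INR n) = g x).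
  { induction n as [|n IH]; intros x; [simpl; f_equal; ring|].
    rewrite S_INR, <- Rplus_assoc, Hg. apply IH. }
  intros k x. destruct (Z.le_gt_cases 0 k) as [H|H].
  - rewrite <- (Z2Nat.id k H), <- INR_IZR_INZ. apply Hn.
  - rewrite <- (Hn (Z.to_nat (- k)) (x + IZR k)). f_equal.
    rewrite INR_IZR_INZ, Z2Nat.id by lia. rewrite opp_IZR. ring.
Qed.

Lemma per_frac (g : R -> R) : (forall x, g (x + 1) = g x) -> forall x, g (frac_part x) = g x.
Proof.
  intros Hg x. unfold frac_part.
  replace (x - IZR (Int_part x)) with (x + IZR (- Int_part x)) by (rewrite opp_IZR; ring).
  now apply per_IZR.
Qed.

Lemma pri_ext f g : (forall x, f x = g x) -> pri f -> pri g.
Proof.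
  intros H [H1 H2]. split.
  - intros x. now rewrite <- !H.
  - apply ex_RInt_ext with f; auto.
Qed.

Lemma pri_const c : pri (fun _ => c).
Proof. split; [reflexivity|apply ex_RInt_const]. Qed.

Lemma pri_plus f g : pri f -> pri g -> pri (fun x => f x + g x).
Proof.
  intros [H1 H2] [H3 H4]. split; [intros x; now rewrite H1, H3|].
  now apply (ex_RInt_plus (V := R_NormedModule)).
Qed.

Lemma pri_minus f g : pri f -> pri g -> pri (fun x => f x - g x).
Proof.
  intros [H1 H2] [H3 H4]. split; [intros x; now rewrite H1, H3|].
  now apply (ex_RInt_minus (V := R_NormedModule)).
Qed.

Lemma pri_mult f g : pri f -> pri g -> pri (fun x => f x * g x).
Proof.
  intros [H1 H2] [H3 H4]. split; [intros x; now rewrite H1, H3|].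
  now apply ex_RInt_mult.
Qed.

Lemma pri_opp f : pri f -> pri (fun x => - f x).
Proof.
  intros H. apply pri_ext with (fun x => 0 - f x); [intros; ring|].
  apply pri_minus; [apply pri_const|exact H].
Qed.

Lemma pri_abs f : pri f -> pri (fun x => Rabs (f x)).
Proof.
  intros [H1 H2]. split; [intros x; now rewrite H1|].
  apply (ex_RInt_norm f 0 1 H2).
Qed.

Lemma RInt_translate (f : R -> R) v a b : ex_RInt f (a + v) (b + v) ->
  ex_RInt (fun y => f (y + v)) a b /\ RInt (fun y => f (y + v)) a b = RInt f (a + v) (b + v).
Proof.
  intros H.
  assert (E : forall y, scal 1 (f (1 * y + v)) = f (y + v)).
  { intros y. rewrite (Rmult_1_l y). apply (Rmult_1_l (f (y + v))). }
  rewrite <- (Rmult_1_l a), <- (Rmult_1_l b) in H.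
  split.
  - apply ex_RInt_ext with (fun y => scal 1 (f (1 * y + v))); [intros; apply E|].
    now apply (ex_RInt_comp_lin (V := R_NormedModule) f 1 v).
  - rewrite <- (RInt_ext (fun y => scal 1 (f (1 * y + v)))) by (intros; apply E).
    rewrite (RInt_comp_lin (V := R_CompleteNormedModule) f 1 v) by exact H.
    now rewrite !Rmult_1_l.
Qed.

(** The part of the window beyond 1 is moved back to [0, u] by periodicity. *)
Lemma RInt_window f u : 0 <= u <= 1 -> pri f ->
  ex_RInt f u (u + 1) /\ RInt f u (u + 1) = mean f.
Proof.
  intros Hu [H1 H2].
  assert (A : ex_RInt f 0 u) by (apply (ex_RInt_Chasles_1 (V := R_CompleteNormedModule)) with 1; auto).
  assert (C : ex_RInt f u 1) by (apply (ex_RInt_Chasles_2 (V := R_CompleteNormedModule)) with 0; auto).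
  destruct (RInt_translate f (- (1)) 1 (u + 1)) as [D D'].
  { replace (1 + - (1)) with 0 by ring. replace (u + 1 + - (1)) with u by ring. exact A. }
  assert (E : forall y, f (y + - (1)) = f y).
  { intros y. rewrite <- (H1 (y + - (1))). f_equal. ring. }
  assert (F : ex_RInt f 1 (u + 1)) by (revert D; apply ex_RInt_ext; intros; apply E).
  rewrite (RInt_ext _ f) in D' by (intros; apply E).
  split; [now apply (ex_RInt_Chasles (V := R_NormedModule)) with 1|].
  rewrite <- (RInt_Chasles f u 1 (u + 1)) by assumption.
  unfold mean. rewrite <- (RInt_Chasles f 0 u 1) by assumption.
  rewrite D'. replace (1 + - (1)) with 0 by ring. replace (u + 1 + - (1)) with u by ring.
  unfold plus; simpl. ring.
Qed.

Lemma mean_ext f g : (forall x, f x = g x) -> mean f = mean g.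
Proof. intros H. apply RInt_ext. auto. Qed.

(** Only the fractional part of [s] matters, which reduces the claim to a window starting in
    [0, 1]. *)
Lemma translate_invariance f s : pri f -> pri (fun x => f (x + s)) /\ mean (fun x => f (x + s)) = mean f.
Proof.
  intros Hf. set (u := frac_part s).
  assert (Hu : 0 <= u <= 1) by (unfold u; destruct (base_fp s); lra).
  assert (E : forall x, f (x + u) = f (x + s)).
  { intros x. unfold u, frac_part.
    replace (x + (s - IZR (Int_part s))) with (x + s + IZR (- Int_part s))
      by (rewrite opp_IZR; ring).
    apply per_IZR, Hf. }
  destruct (RInt_window f u Hu Hf) as [H1 H2].
  destruct (RInt_translate f u 0 1) as [H3 H4].
  { now rewrite Rplus_0_l, Rplus_comm. }
  split; [split|].
  - intros x. replace (x + 1 + s) with (x + s + 1) by ring. apply Hf.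
  - revert H3. apply ex_RInt_ext. intros; apply E.
  - rewrite <- H2, <- (mean_ext _ _ E). unfold mean. rewrite H4. f_equal; ring.
Qed.

Lemma pri_shift f s : pri f -> pri (fun x => f (x + s)).
Proof. intros Hf. now apply translate_invariance. Qed.

Lemma pri_shift_minus f s : pri f -> pri (fun x => f (x - s)).
Proof. intros Hf. now apply (pri_shift f (- s)). Qed.

Lemma mean_shift f s : pri f -> mean (fun x => f (x + s)) = mean f.
Proof. intros Hf. now apply translate_invariance. Qed.

Lemma mean_shift_minus f s : pri f -> mean (fun x => f (x - s)) = mean f.
Proof. intros Hf. now apply (mean_shift f (- s)). Qed.

Lemma mean_const c : mean (fun _ => c) = c.
Proof. unfold mean. rewrite RInt_const. unfold scal; simpl; unfold mult; simpl. ring. Qed.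

Lemma mean_plus f g : pri f -> pri g -> mean (fun x => f x + g x) = mean f + mean g.
Proof. intros [_ Hf] [_ Hg]. now apply (RInt_plus (V := R_CompleteNormedModule)). Qed.

Lemma mean_minus f g : pri f -> pri g -> mean (fun x => f x - g x) = mean f - mean g.
Proof. intros [_ Hf] [_ Hg]. now apply (RInt_minus (V := R_CompleteNormedModule)). Qed.

Lemma mean_scal c f : pri f -> mean (fun x => c * f x) = c * mean f.
Proof. intros [_ Hf]. now apply (RInt_scal (V := R_CompleteNormedModule)). Qed.

Lemma mean_le f g : pri f -> pri g -> (forall x, f x <= g x) -> mean f <= mean g.
Proof. intros [_ Hf] [_ Hg] H. apply RInt_le; auto; lra. Qed.

Lemma mean_nonneg f : pri f -> (forall x, 0 <= f x) -> 0 <= mean f.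
Proof. intros Hf H. rewrite <- (mean_const 0). apply mean_le; auto using pri_const. Qed.

Lemma mean_abs_le f g : pri f -> pri g -> (forall x, Rabs (f x) <= g x) -> Rabs (mean f) <= mean g.
Proof.
  intros Hf Hg H. apply Rabs_le. split.
  - rewrite <- (Rmult_1_l (mean g)), Ropp_mult_distr_l, <- mean_scal by assumption.
    apply mean_le; [apply pri_mult; auto using pri_const|assumption|].
    intros x. specialize (H x). apply Rabs_le_between in H. lra.
  - apply mean_le; auto. intros x. specialize (H x). apply Rabs_le_between in H. lra.
Qed.

Lemma pri_rsum (F : nat -> R -> R) n : (forall k, (k < n)%nat -> pri (F k)) -> pri (fun x => rsum (fun k => F k x) n).
Proof.
  induction n as [|n IH]; intros H; simpl; [apply pri_const|].
  apply pri_plus; [apply IH; intros; apply H|apply H]; lia.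
Qed.

Lemma mean_rsum (F : nat -> R -> R) n : (forall k, (k < n)%nat -> pri (F k)) ->
  mean (fun x => rsum (fun k => F k x) n) = rsum (fun k => mean (F k)) n.
Proof.
  induction n as [|n IH]; intros H; simpl; [apply mean_const|].
  rewrite mean_plus, IH; auto.
  apply pri_rsum; auto.
Qed.

Lemma pri_bounded f : pri f -> exists B, 0 <= B /\ forall x, Rabs (f x) <= B.
Proof.
  intros [H1 H2]. destruct (ex_RInt_ub f 0 1 H2) as [M HM].
  rewrite Rmin_left, Rmax_right in HM by lra.
  assert (H : forall x, Rabs (f x) <= M).
  { intros x. rewrite <- (per_frac f H1 x). apply HM. destruct (base_fp x); lra. }
  exists M. split; [|exact H]. apply Rle_trans with (2 := H 0), Rabs_pos.
Qed.

Ltac pri :=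
  repeat match goal with
  | |- pri _ => assumption
  | |- pri (fun x => _ + _) => apply pri_plus
  | |- pri (fun x => _ - _) => apply pri_minus
  | |- pri (fun x => _ * _) => apply pri_mult
  | |- pri (fun x => - _) => apply pri_opp
  | |- pri (fun x => ?f (x - ?s)) => apply (pri_shift_minus f s)
  | |- pri (fun x => ?f (x + ?s)) => apply (pri_shift f s)
  | |- pri (fun x => rsum _ _) => apply pri_rsum; intros
  | |- pri (fun x => Rabs _) => apply pri_abs
  | |- pri (fun x => ?f x) => change (pri f)
  | |- pri (fun x => ?c) => exact (pri_const c)
  end.

(** * Trigonometric polynomials *)

(** The free phase [th] covers sines and makes translation by any [s] stay inside the class. Closure
    under pointwise equality, [tp_ext], does the work of functional extensionality. *)
Inductive tp (D : nat) : (R -> R) -> Prop :=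
| tp_cos m th : (Z.abs m <= Z.of_nat D)%Z -> tp D (fun x => cos (2 * PI * IZR m * x + th))
| tp_plus P Q : tp D P -> tp D Q -> tp D (fun x => P x + Q x)
| tp_scal c P : tp D P -> tp D (fun x => c * P x)
| tp_ext P Q : (forall x, P x = Q x) -> tp D P -> tp D Q.

Lemma tp_const D c : tp D (fun _ => c).
Proof.
  apply tp_ext with (fun x => c * cos (2 * PI * IZR 0 * x + 0)).
  - intros x. replace (2 * PI * 0 * x + 0) with 0 by ring. rewrite cos_0. ring.
  - apply tp_scal, tp_cos. lia.
Qed.

Lemma tp_cosine D m : (Z.abs m <= Z.of_nat D)%Z -> tp D (fun x => cos (2 * PI * IZR m * x)).
Proof.
  intros H. apply tp_ext with (fun x => cos (2 * PI * IZR m * x + 0)).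
  - intros x. now rewrite Rplus_0_r.
  - now apply tp_cos.
Qed.

Lemma tp_sine D m : (Z.abs m <= Z.of_nat D)%Z -> tp D (fun x => sin (2 * PI * IZR m * x)).
Proof.
  intros H. apply tp_ext with (fun x => cos (2 * PI * IZR m * x + - (PI / 2))).
  - intros x. rewrite cos_plus, cos_neg, sin_neg, cos_PI2, sin_PI2. ring.
  - now apply tp_cos.
Qed.

Lemma tp_minus D P Q : tp D P -> tp D Q -> tp D (fun x => P x - Q x).
Proof.
  intros HP HQ. apply tp_ext with (fun x => P x + (-1) * Q x); [intros; ring|].
  now apply tp_plus, tp_scal.
Qed.

Lemma tp_mono D E P : (D <= E)%nat -> tp D P -> tp E P.
Proof.
  intros H. induction 1.
  - apply tp_cos. lia.
  - now apply tp_plus.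
  - now apply tp_scal.
  - now apply tp_ext with P.
Qed.

Lemma tp_shift D P s : tp D P -> tp D (fun x => P (x - s)).
Proof.
  induction 1 as [m th H|P Q _ IHP _ IHQ|c P _ IHP|P Q HE _ IHP].
  - apply tp_ext with (fun x => cos (2 * PI * IZR m * x + (th - 2 * PI * IZR m * s))).
    + intros x. f_equal. ring.
    + now apply tp_cos.
  - now apply (tp_plus D (fun x => P (x - s))).
  - now apply (tp_scal D c (fun x => P (x - s))).
  - apply tp_ext with (2 := IHP). intros x. apply HE.
Qed.

Lemma tp_mult D E P Q : tp D P -> tp E Q -> tp (D + E) (fun x => P x * Q x).
Proof.
  intros HP HQ. induction HP as [m th H|P P' _ IHP _ IHQ|c P _ IHP|P P' HE _ IHP].
  - induction HQ as [m' th' H'|Q Q' _ IHP _ IHQ|c Q _ IHP|Q Q' HE _ IHP].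
    + apply tp_ext with (fun x =>
        / 2 * (cos (2 * PI * IZR (m - m') * x + (th - th'))
               + cos (2 * PI * IZR (m + m') * x + (th + th')))).
      * intros x. rewrite minus_IZR, plus_IZR.
        replace (2 * PI * (IZR m - IZR m') * x + (th - th'))
          with ((2 * PI * IZR m * x + th) - (2 * PI * IZR m' * x + th')) by ring.
        replace (2 * PI * (IZR m + IZR m') * x + (th + th'))
          with ((2 * PI * IZR m * x + th) + (2 * PI * IZR m' * x + th')) by ring.
        generalize (2 * PI * IZR m * x + th) (2 * PI * IZR m' * x + th'); intros u v.
        rewrite cos_minus, cos_plus. field.
      * apply tp_scal, tp_plus; apply tp_cos; lia.
    + apply tp_ext with (2 := tp_plus _ _ _ IHP IHQ). intros x; simpl; ring.
    + apply tp_ext with (2 := tp_scal _ c _ IHP). intros x; simpl; ring.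
    + apply tp_ext with (2 := IHP). intros x. now rewrite HE.
  - apply tp_ext with (2 := tp_plus _ _ _ IHP IHQ). intros x; simpl; ring.
  - apply tp_ext with (2 := tp_scal _ c _ IHP). intros x; simpl; ring.
  - apply tp_ext with (2 := IHP). intros x. now rewrite HE.
Qed.

Lemma tp_rsum D (F : nat -> R -> R) n : (forall k, (k < n)%nat -> tp D (F k)) ->
  tp D (fun x => rsum (fun k => F k x) n).
Proof.
  induction n as [|n IH]; intros H; simpl; [apply tp_const|].
  apply (tp_plus D (fun x => rsum (fun k => F k x) n)); [apply IH; intros; apply H|apply H]; lia.
Qed.

Lemma pri_cos m th : pri (fun x => cos (2 * PI * IZR m * x + th)).
Proof.
  split.
  - intros x. replace (2 * PI * IZR m * (x + 1) + th)
      with (2 * PI * IZR m * x + th + 2 * IZR m * PI) by ring.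
    destruct (Z.le_gt_cases 0 m) as [H|H].
    + rewrite <- (Z2Nat.id m H), <- INR_IZR_INZ. apply cos_period.
    + rewrite <- (cos_period (2 * PI * IZR m * x + th + 2 * IZR m * PI) (Z.to_nat (- m))).
      f_equal. rewrite INR_IZR_INZ, Z2Nat.id, opp_IZR by lia. ring.
  - apply (ex_RInt_continuous (V := R_CompleteNormedModule)). intros z _.
    apply continuity_pt_filterlim. reg.
Qed.

Lemma tp_pri D P : tp D P -> pri P.
Proof.
  induction 1; pri.
  - apply pri_cos.
  - now apply pri_ext with P.
Qed.

(** A difference of two cosines is a product of two sines, one of which is at most half the
    difference of the arguments. This is what later gives continuity of correlations in the shift,
    which [F] itself does not supply. *)
Lemma tp_lipschitz D P : tp D P ->
  exists L, 0 <= L /\ forall x y, Rabs (P x - P y) <= L * Rabs (x - y).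
Proof.
  induction 1 as [m th H|P Q _ IHP _ IHQ|c P _ IHP|P Q HE _ IHP].
  - exists (Rabs (2 * PI * IZR m)). split; [apply Rabs_pos|]. intros x y.
    replace (cos (2 * PI * IZR m * x + th) - cos (2 * PI * IZR m * y + th)) with
      (-2 * sin ((2 * PI * IZR m * x + th - (2 * PI * IZR m * y + th)) / 2)
          * sin ((2 * PI * IZR m * x + th + (2 * PI * IZR m * y + th)) / 2))
      by (rewrite <- form2; reflexivity).
    set (u := (2 * PI * IZR m * x + th - (2 * PI * IZR m * y + th)) / 2).
    set (v := (2 * PI * IZR m * x + th + (2 * PI * IZR m * y + th)) / 2).
    rewrite <- Rabs_mult.
    replace (2 * PI * IZR m * (x - y)) with (2 * u) by (unfold u; field).
    rewrite !Rabs_mult, (Rabs_left (-2)) by lra.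
    assert (Hu : Rabs (sin u) <= Rabs u).
    { destruct (Rle_or_lt 0 u) as [Hu|Hu].
      - rewrite (Rabs_pos_eq u) by lra. apply Rabs_le.
        destruct Hu as [Hu|<-]; [|rewrite sin_0; lra].
        generalize (sin_lt_x u Hu); intros.
        destruct (Rle_or_lt u 1).
        + assert (0 <= sin u) by (apply sin_ge_0; generalize PI2_1; lra). lra.
        + destruct (SIN_bound u); lra.
      - rewrite (Rabs_left u) by lra. rewrite <- Rabs_Ropp, <- sin_neg. apply Rabs_le.
        assert (Hu' : 0 < - u) by lra.
        generalize (sin_lt_x (- u) Hu'); intros.
        destruct (Rle_or_lt (- u) 1).
        + assert (0 <= sin (- u)) by (apply sin_ge_0; generalize PI2_1; lra). lra.
        + destruct (SIN_bound (- u)); lra. }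
    assert (Hv : Rabs (sin v) <= 1) by (apply Rabs_le, SIN_bound).
    rewrite (Rabs_pos_eq 2) by lra.
    generalize (Rabs_pos (sin u)) (Rabs_pos (sin v)); nra.
  - destruct IHP as (L & HL & H1). destruct IHQ as (L' & HL' & H2).
    exists (L + L'). split; [lra|]. intros x y.
    replace (P x + Q x - (P y + Q y)) with ((P x - P y) + (Q x - Q y)) by ring.
    eapply Rle_trans; [apply Rabs_triang|]. specialize (H1 x y). specialize (H2 x y). lra.
  - destruct IHP as (L & HL & H1). exists (Rabs c * L).
    split; [apply Rmult_le_pos; auto using Rabs_pos|]. intros x y.
    rewrite <- Rmult_minus_distr_l, Rabs_mult, Rmult_assoc.
    apply Rmult_le_compat_l; auto using Rabs_pos.
  - destruct IHP as (L & HL & H1). exists L. split; [exact HL|]. intros x y. now rewrite <- !HE.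
Qed.

Lemma mean_cos m th : mean (fun x => cos (2 * PI * IZR m * x + th)) =
  if Z.eqb m 0 then cos th else 0.
Proof.
  destruct (Z.eqb_spec m 0) as [->|Hm].
  - rewrite <- (mean_const (cos th)). apply mean_ext. intros x. f_equal. ring.
  - assert (Hk : 2 * PI * IZR m <> 0).
    { apply Rmult_integral_contrapositive. split; [generalize PI_RGT_0; lra|].
      now apply not_0_IZR. }
    set (k := 2 * PI * IZR m) in *.
    set (G := fun x => sin (k * x + th) / k).
    unfold mean. transitivity (G 1 - G 0).
    + apply is_RInt_unique, (is_RInt_derive (V := R_CompleteNormedModule)).
      * intros x _. unfold G. auto_derive; [exact I|]. field. exact Hk.
      * intros x _. apply continuity_pt_filterlim. reg.
    (* The antiderivative [G] has equal values at 0 and 1, because a sine is a phase-shifted cosine,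
       whose period 1 is already proved. *)
    + destruct (pri_cos m (th - PI / 2)) as [HP _]. specialize (HP 0).
      unfold G. fold k in HP. rewrite Rplus_0_l in HP.
      replace (k * 1 + (th - PI / 2)) with (- (PI / 2 - (k * 1 + th))) in HP by ring.
      replace (k * 0 + (th - PI / 2)) with (- (PI / 2 - (k * 0 + th))) in HP by ring.
      rewrite !cos_neg, !cos_shift in HP. rewrite HP. field. exact Hk.
Qed.

(** Multiplication by [2 * sin (a / 2)] turns each cosine into a difference of consecutive sines, so
    the sum telescopes. *)
Lemma cos_sum a th n : 2 * sin (a / 2) * rsum (fun k => cos (INR k * a + th)) n =
  sin (INR n * a - a / 2 + th) + sin (a / 2 - th).
Proof.
  induction n as [|n IH].
  - simpl. replace (a / 2 - th) with (- (0 * a - a / 2 + th)) by ring. rewrite sin_neg. ring.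
  - simpl rsum. rewrite Rmult_plus_distr_l, IH, S_INR.
    replace (INR n * a - a / 2 + th) with ((INR n * a + th) - a / 2) by field.
    replace ((INR n + 1) * a - a / 2 + th) with ((INR n * a + th) + a / 2) by field.
    rewrite (sin_minus (INR n * a + th)), (sin_plus (INR n * a + th)). ring.
Qed.

Lemma cos_sum_bound a th n s : 0 < s -> s <= Rabs (sin (a / 2)) ->
  Rabs (rsum (fun k => cos (INR k * a + th)) n) <= / s.
Proof.
  intros Hs Ha. set (S := rsum _ n).
  assert (H : Rabs (2 * sin (a / 2) * S) <= 2).
  { unfold S. rewrite cos_sum. eapply Rle_trans; [apply Rabs_triang|].
    assert (B : forall u, Rabs (sin u) <= 1) by (intros; apply Rabs_le, SIN_bound).
    generalize (B (INR n * a - a / 2 + th)) (B (a / 2 - th)). lra. }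
  rewrite !Rabs_mult, (Rabs_pos_eq 2) in H by lra.
  apply Rmult_le_reg_l with s; [exact Hs|]. rewrite Rinv_r by lra.
  generalize (Rabs_pos S). nra.
Qed.

(** A zero of the sine means that [m * beta] is an integer. The sine form is used because it is the
    denominator in the bound for sums of cosines. *)
Definition nonresonant (D : nat) (beta : R) : Prop :=
  forall m, (0 < Z.abs m <= Z.of_nat D)%Z -> sin (PI * IZR m * beta) <> 0.

(** By [cos_sum_bound] every non-constant wave has bounded partial sums. The constant [C] is uniform
    in the starting point [y], so it survives moving the start of the window with [n]. *)
Lemma tp_orbit_average D P beta : nonresonant D beta -> tp D P ->
  exists C, forall y n, Rabs (rsum (fun k => P (y + INR k * beta)) n - INR n * mean P) <= C.
Proof.
  intros Hb. induction 1 as [m th H|P Q HP IHP HQ IHQ|c P HP IHP|P Q HE HP IHP].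
  - rewrite mean_cos. destruct (Z.eqb_spec m 0) as [->|Hm].
    + exists 0. intros y n. rewrite (rsum_ext _ (fun _ => cos th)).
      * rewrite rsum_const. replace (_ - _) with 0 by ring. rewrite Rabs_R0. lra.
      * intros k _. f_equal. ring.
    + exists (/ Rabs (sin (PI * IZR m * beta))). intros y n.
      rewrite Rmult_0_r, Rminus_0_r.
      rewrite (rsum_ext _ (fun k => cos (INR k * (2 * (PI * IZR m * beta)) + (2 * PI * IZR m * y + th))))
        by (intros; f_equal; ring).
      apply cos_sum_bound.
      * apply Rabs_pos_lt, Hb. lia.
      * replace (2 * (PI * IZR m * beta) / 2) with (PI * IZR m * beta) by field. lra.
  - destruct IHP as [C1 H1]. destruct IHQ as [C2 H2]. exists (C1 + C2). intros y n.
    rewrite rsum_plus, mean_plus by (eapply tp_pri; eassumption).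
    match goal with |- Rabs ?t <= _ => replace t with
      ((rsum (fun k => P (y + INR k * beta)) n - INR n * mean P) +
       (rsum (fun k => Q (y + INR k * beta)) n - INR n * mean Q)) by ring end.
    eapply Rle_trans; [apply Rabs_triang|]. apply Rplus_le_compat; auto.
  - destruct IHP as [C1 H1]. exists (Rabs c * C1). intros y n.
    rewrite rsum_scal, mean_scal by (eapply tp_pri; eassumption).
    match goal with |- Rabs ?t <= _ => replace t with
      (c * (rsum (fun k => P (y + INR k * beta)) n - INR n * mean P)) by ring end.
    rewrite Rabs_mult. apply Rmult_le_compat_l; auto using Rabs_pos.
  - destruct IHP as [C1 H1]. exists C1. intros y n.
    rewrite <- (mean_ext P Q HE). rewrite (rsum_ext _ (fun k => P (y + INR k * beta))) by (intros; now rewrite HE).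
    apply H1.
Qed.

(** Equally spaced quadrature is exact below its aliasing frequency: a frequency [m] with
    [0 < |m| <= D < M] is not a multiple of [M], so its samples run over full turns and cancel. *)
Lemma tp_grid_average D P M x : (D < M)%nat -> tp D P ->
  rsum (fun i => P (x - INR i / INR M)) M = INR M * mean P.
Proof.
  intros HM.
  assert (HM0 : INR M <> 0) by (apply not_0_INR; lia).
  induction 1 as [m th H|P Q HP IHP HQ IHQ|c P HP IHP|P Q HE HP IHP].
  - rewrite mean_cos. destruct (Z.eqb_spec m 0) as [->|Hm].
    + rewrite (rsum_ext _ (fun _ => cos th)); [apply rsum_const|].
      intros; f_equal; ring.
    + rewrite Rmult_0_r. set (b := PI * (IZR m / INR M)).
      assert (Hb : sin b <> 0).
      { intros H0. apply sin_eq_0_0 in H0. destruct H0 as [k Hk].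
        assert (Hk' : IZR m = IZR (k * Z.of_nat M)).
        { rewrite mult_IZR, <- INR_IZR_INZ. unfold b in Hk.
          generalize PI_RGT_0; intros Hpi.
          apply Rmult_eq_reg_l with (PI / INR M).
          - replace (PI / INR M * IZR m) with (PI * (IZR m / INR M)) by (field; lra).
            rewrite Hk. field. lra.
          - apply Rmult_integral_contrapositive; split; [lra|]. now apply Rinv_neq_0_compat. }
        apply eq_IZR in Hk'. assert (k <> 0)%Z by (intros ->; lia). nia. }
      rewrite (rsum_ext _ (fun i => cos (INR i * (2 * - b) + (2 * PI * IZR m * x + th))))
        by (intros; f_equal; unfold b; field; exact HM0).
      apply Rmult_eq_reg_l with (2 * sin (2 * - b / 2)).
      2: { replace (2 * - b / 2) with (- b) by field. rewrite sin_neg. lra. }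
      rewrite cos_sum. replace (2 * - b / 2) with (- b) by field.
      set (t := 2 * PI * IZR m * x + th).
      destruct (pri_cos m (PI / 2 - (b + t))) as [HP _].
      assert (HQ := per_IZR _ HP (-1) 0). cbv beta in HQ.
      replace (2 * PI * IZR m * (0 + -1) + (PI / 2 - (b + t)))
        with (PI / 2 - (- (INR M * (2 * - b)) + b + t)) in HQ by (unfold b; field; exact HM0).
      replace (2 * PI * IZR m * 0 + (PI / 2 - (b + t))) with (PI / 2 - (b + t)) in HQ by ring.
      clear HP. destruct (pri_cos m (PI / 2 - (t + b))) as [HP _].
      assert (HR := per_IZR _ HP 1 0). cbv beta in HR.
      replace (2 * PI * IZR m * (0 + 1) + (PI / 2 - (t + b)))
        with (PI / 2 - (INR M * (2 * - b) - - b + t)) in HR by (unfold b; field; exact HM0).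
      replace (2 * PI * IZR m * 0 + (PI / 2 - (t + b))) with (PI / 2 - (t + b)) in HR by ring.
      rewrite !cos_shift in HR. rewrite HR.
      replace (- b - t) with (- (t + b)) by ring. rewrite sin_neg. ring.
  - rewrite rsum_plus, mean_plus, IHP, IHQ by (eapply tp_pri; eassumption). ring.
  - rewrite rsum_scal, mean_scal, IHP by (eapply tp_pri; eassumption). ring.
  - rewrite <- (mean_ext P Q HE), <- IHP. apply rsum_ext. intros; now rewrite HE.
Qed.

(** The Fejer kernel, written as the squared modulus of a geometric sum of exponentials divided by
    [N], so that positivity is immediate. *)
Definition fejer (N : nat) (x : R) : R :=
  / INR N * (rsum (fun k => cos (2 * PI * IZR (Z.of_nat k) * x)) N
               * rsum (fun k => cos (2 * PI * IZR (Z.of_nat k) * x)) N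
             + rsum (fun k => sin (2 * PI * IZR (Z.of_nat k) * x)) N
               * rsum (fun k => sin (2 * PI * IZR (Z.of_nat k) * x)) N).

Lemma tp_fejer N : tp (N + N) (fejer N).
Proof.
  apply tp_scal, tp_plus; apply tp_mult; apply tp_rsum; intros k Hk;
    (apply tp_cosine || apply tp_sine); lia.
Qed.

Lemma fejer_nonneg N x : (0 < N)%nat -> 0 <= fejer N x.
Proof.
  intros HN. apply Rmult_le_pos; [left; apply Rinv_0_lt_compat, lt_0_INR, HN|].
  apply Rplus_le_le_0_compat; apply Rle_0_sqr.
Qed.

(** Expanding the square gives cosines of frequency [j - k]; only the [N] diagonal terms have
    nonzero mean. *)
Lemma mean_fejer N : (0 < N)%nat -> mean (fejer N) = 1.
Proof.
  intros HN. assert (HN0 : INR N <> 0) by (apply not_0_INR; lia).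
  assert (Hc : forall j k, pri (fun x => cos (2 * PI * IZR (Z.of_nat j - Z.of_nat k) * x + 0)))
    by (intros; apply pri_cos).
  rewrite (mean_ext _ (fun x => / INR N * rsum (fun j => rsum (fun k =>
    cos (2 * PI * IZR (Z.of_nat j - Z.of_nat k) * x + 0)) N) N)).
  - rewrite mean_scal.
    2: { apply pri_rsum; intros; apply pri_rsum; auto. }
    rewrite (mean_rsum (fun j x => rsum (fun k =>
      cos (2 * PI * IZR (Z.of_nat j - Z.of_nat k) * x + 0)) N)).
    2: { intros; apply pri_rsum; auto. }
    rewrite (rsum_ext _ (fun _ => 1)).
    + rewrite rsum_const. field. exact HN0.
    + intros j Hj. rewrite mean_rsum by auto.
      rewrite (rsum_ext _ (fun k => if Nat.eqb k j then 1 else 0)).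
      * exact (rsum_pick (fun _ => 1) N j Hj).
      * intros k _. rewrite mean_cos, cos_0.
        destruct (Nat.eqb_spec k j), (Z.eqb_spec (Z.of_nat j - Z.of_nat k) 0); auto; lia.
  - intros x. unfold fejer. f_equal. rewrite !rsum_mult, <- rsum_plus.
    apply rsum_ext; intros j _. rewrite <- rsum_plus. apply rsum_ext; intros k _.
    rewrite Rplus_0_r, minus_IZR, <- cos_minus. f_equal. ring.
Qed.

Lemma fejer_far N x s : (0 < N)%nat -> 0 < s -> s <= Rabs (sin (PI * x)) ->
  fejer N x <= / INR N * (2 * (/ s * / s)).
Proof.
  intros HN Hs Hx. apply Rmult_le_compat_l.
  { left. apply Rinv_0_lt_compat, lt_0_INR, HN. }
  assert (H : forall th, Rabs (rsum (fun k => cos (INR k * (2 * PI * x) + th)) N) <= / s).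
  { intros th. apply cos_sum_bound; [exact Hs|].
    replace (2 * PI * x / 2) with (PI * x) by field. exact Hx. }
  assert (Q : forall u, Rabs u <= / s -> u * u <= / s * / s).
  { intros u Hu. replace (u * u) with (Rabs u * Rabs u)
      by (rewrite <- Rabs_mult; apply Rabs_pos_eq, Rle_0_sqr).
    apply Rmult_le_compat; auto using Rabs_pos. }
  replace (2 * (/ s * / s)) with (/ s * / s + / s * / s) by ring. apply Rplus_le_compat; apply Q.
  - rewrite (rsum_ext _ (fun k => cos (INR k * (2 * PI * x) + 0))); [apply H|].
    intros k _. rewrite <- INR_IZR_INZ. f_equal. ring.
  - rewrite (rsum_ext _ (fun k => cos (INR k * (2 * PI * x) + - (PI / 2)))); [apply H|].
    intros k _. rewrite <- INR_IZR_INZ, cos_plus, cos_neg, sin_neg, cos_PI2, sin_PI2.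
    replace (2 * PI * INR k * x) with (INR k * (2 * PI * x)) by ring. ring.
Qed.

(** * Squeezing by trigonometric polynomials *)

Lemma Riemann_sum_mkseq (F : R -> R) (tau : R -> R -> R) (n : nat) : forall g : nat -> R,
  Riemann_sum F (SF_seq_f2 tau (seq.mkseq g (S n))) =
  rsum (fun i => (g (S i) - g i) * F (tau (g i) (g (S i)))) n.
Proof.
  induction n as [|n IH]; intros g; [reflexivity|].
  assert (Hs : forall (h : nat -> R) m, seq.mkseq h (S m) = (h O :: seq.mkseq (fun i => h (S i)) m)%list).
  { intros h m. unfold seq.mkseq. simpl. f_equal.
    change 1%nat with (1 + 0)%nat. rewrite seq.iotaDl, <- seq.map_comp. reflexivity. }
  rewrite rsum_first, <- (IH (fun i => g (S i))).
  rewrite (Hs g), (Hs (fun i => g (S i))).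
  exact (Riemann_sum_cons F (g 0%nat, tau (g 0%nat) (g 1%nat))
    (SF_seq_f2 tau (g 1%nat :: seq.mkseq (fun i => g (S (S i))) n)%list)).
Qed.

(** Moving the window by one step drops a term and gains the term one period later, which is
    equal. *)
Lemma periodic_window_sum (u : Z -> R) (q : nat) : (forall k, u (k + Z.of_nat q)%Z = u k) ->
  forall s, rsum (fun k => u (s + Z.of_nat k)%Z) q = rsum (fun k => u (Z.of_nat k)) q.
Proof.
  intros Hu.
  assert (Hstep : forall s, rsum (fun k => u (s + 1 + Z.of_nat k)%Z) q =
                            rsum (fun k => u (s + Z.of_nat k)%Z) q).
  { intros s.
    assert (E := rsum_first (fun k => u (s + Z.of_nat k)%Z) q).
    simpl rsum in E at 1. rewrite Hu, Z.add_0_r in E.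
    rewrite (rsum_ext _ (fun k => u (s + Z.of_nat (S k))%Z)); [lra|].
    intros k _. f_equal. lia. }
  intros s. induction s as [|s IH|s IH] using Z.peano_ind.
  - reflexivity.
  - rewrite <- IH. apply Hstep.
  - rewrite <- IH, <- (Hstep (Z.pred s)). apply rsum_ext. intros k _. f_equal. lia.
Qed.

(** The supremum of [F u - F v] need not be attained, so the pair realises it only up to [e].
    Expressing the oscillation through values of [F] lets Riemann sums of [F] control it. *)
Lemma oscillation_pair (F : R -> R) B e a b : (forall x, Rabs (F x) <= B) -> 0 < e -> a <= b ->
  exists p : R * R, (a <= fst p <= b /\ a <= snd p <= b) /\
    forall u v, a <= u <= b -> a <= v <= b -> F u - F v <= F (fst p) - F (snd p) + e.
Proof.
  intros HB He Hab.
  set (E := fun d => exists u v, a <= u <= b /\ a <= v <= b /\ d = F u - F v).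
  destruct (completeness E) as [S [HS1 HS2]].
  - exists (2 * B). intros d (u & v & _ & _ & ->).
    generalize (HB u) (HB v); intros H1 H2.
    apply Rabs_le_between in H1, H2. lra.
  - exists (F a - F a), a, a. repeat split; lra.
  - assert (H : exists d, E d /\ S - e < d).
    { apply Classical_Prop.NNPP. intros Hn.
      assert (S <= S - e); [|lra]. apply HS2. intros d Hd.
      destruct (Rle_or_lt d (S - e)); [assumption|]. exfalso. apply Hn. now exists d. }
    destruct H as (d & (u0 & v0 & Hu0 & Hv0 & ->) & Hd).
    exists (u0, v0). simpl. split; [auto|]. intros u v Hu Hv.
    assert (F u - F v <= S) by (apply HS1; exists u, v; auto). lra.
Qed.

(* Riemann sums whose tags nearly realise the oscillation of each cell. *)
Lemma small_oscillation F eps : pri F -> 0 < eps ->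
  exists (n : nat) (O : Z -> R), (2 <= n)%nat /\
    (forall k, O (k + Z.of_nat n)%Z = O k) /\ (forall k, 0 <= O k) /\
    (forall k x y, IZR k / INR n <= x <= (IZR k + 1) / INR n ->
       IZR k / INR n <= y <= (IZR k + 1) / INR n -> Rabs (F x - F y) <= O k) /\
    rsum (fun k => O (Z.of_nat k)) n <= INR n * eps.
Proof.
  intros HF Heps. destruct (pri_bounded F HF) as (B & HB0 & HB).
  (* One [e] for each of the two Riemann sums compared with the integral, and one for the slack in
     the near-optimal pairs. *)
  set (e := eps / 3). assert (He : 0 < e) by (unfold e; lra).
  assert (Hsel : forall a b, {p : R * R | a <= b ->
    (a <= fst p <= b /\ a <= snd p <= b) /\
    forall u v, a <= u <= b -> a <= v <= b -> F u - F v <= F (fst p) - F (snd p) + e}).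
  { intros a b. apply constructive_indefinite_description.
    destruct (Rle_or_lt a b) as [Hab|Hab]; [|exists (0, 0); intros; lra].
    destruct (oscillation_pair F B e a b HB He Hab) as [p Hp]. now exists p. }
  set (t1 := fun a b => fst (proj1_sig (Hsel a b))).
  set (t2 := fun a b => snd (proj1_sig (Hsel a b))).
  destruct HF as [Hper [I HI]].
  assert (Hloc : locally I (fun v => Rabs (v - I) < e)).
  { exists (mkposreal e He). intros v Hv. exact Hv. }
  apply HI in Hloc. destruct Hloc as [d Hd].
  destruct (archimed_cor1 d (cond_pos d)) as (n0 & Hn0 & Hn0').
  (* [unif_part 0 1 n0] has [n0 + 1] cells. As [n0] is positive, [n] is at least 2, which later
     keeps [PI / INR n] below or at [PI / 2]. *)
  set (n := S n0). assert (Hn : 0 < INR n) by (apply lt_0_INR; unfold n; lia).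
  (* The mesh is fixed before the tags, so the same [n] serves the upper tags [t1] and the lower
     tags [t2]. *)
  assert (Hsum : forall tau, (forall a b, a <= b -> a <= tau a b <= b) ->
    Rabs (rsum (fun i => / INR n * F (tau (INR i / INR n) (INR (S i) / INR n))) n - I) < e).
  { intros tau Htau.
    destruct (Riemann_fine_unif_part tau 0 1 n0 Htau) as (H1 & H2 & H3 & H4); [lra|].
    specialize (Hd (SF_seq_f2 tau (unif_part 0 1 n0))).
    assert (Hlt : seq_step (SF_lx (SF_seq_f2 tau (unif_part 0 1 n0))) < d).
    { eapply Rle_lt_trans; [exact H1|]. eapply Rle_lt_trans; [|exact Hn0].
      assert (0 < INR n0) by (apply lt_0_INR; lia).
      unfold Rdiv. rewrite Rminus_0_r, Rmult_1_l. apply Rinv_le_contravar; lra. }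
    specialize (Hd Hlt).
    rewrite Rmin_left, Rmax_right in Hd by lra. specialize (Hd (conj H2 (conj H3 H4))).
    assert (E : Riemann_sum F (SF_seq_f2 tau (unif_part 0 1 n0)) =
      rsum (fun i => / INR n * F (tau (INR i / INR n) (INR (S i) / INR n))) n).
    { unfold unif_part. rewrite Riemann_sum_mkseq. apply rsum_ext. intros i _.
      assert (Hn' : INR n0 + 1 = INR n) by (unfold n; rewrite S_INR; reflexivity).
      rewrite Hn'.
      replace (0 + INR (S i) * (1 - 0) / INR n) with (INR (S i) / INR n) by (field; lra).
      replace (0 + INR i * (1 - 0) / INR n) with (INR i / INR n) by (field; lra).
      f_equal. rewrite S_INR. field. lra. }
    change (Rabs (sign (1 - 0) * Riemann_sum F (SF_seq_f2 tau (unif_part 0 1 n0)) - I) < e) in Hd.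
    rewrite E in Hd.
    replace (sign (1 - 0)) with 1 in Hd by (symmetry; apply sign_eq_1; lra).
    now rewrite Rmult_1_l in Hd. }
  assert (H1 : forall a b, a <= b -> a <= t1 a b <= b).
  { intros a b Hab. apply (proj2_sig (Hsel a b) Hab). }
  assert (H2 : forall a b, a <= b -> a <= t2 a b <= b).
  { intros a b Hab. apply (proj2_sig (Hsel a b) Hab). }
  assert (Hcell : forall k, IZR k / INR n <= (IZR k + 1) / INR n).
  { intros k. apply Rmult_le_compat_r; [left; now apply Rinv_0_lt_compat|lra]. }
  set (O0 := fun k : Z => F (t1 (IZR k / INR n) ((IZR k + 1) / INR n))
                        - F (t2 (IZR k / INR n) ((IZR k + 1) / INR n)) + e).
  assert (HO0 : forall k u v, IZR k / INR n <= u <= (IZR k + 1) / INR n ->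
       IZR k / INR n <= v <= (IZR k + 1) / INR n -> F u - F v <= O0 k).
  { intros k. apply (proj2_sig (Hsel _ _) (Hcell k)). }
  exists n, (fun k => O0 (k mod Z.of_nat n)%Z).
  assert (Hnz : (0 < Z.of_nat n)%Z) by (unfold n; lia).
  split; [unfold n; lia|]. split; [|split; [|split]].
  - intros k. f_equal. rewrite <- (Z.mul_1_l (Z.of_nat n)) at 1. now apply Z_mod_plus_full.
  - intros k. set (k' := (k mod Z.of_nat n)%Z). specialize (Hcell k').
    replace 0 with (F (IZR k' / INR n) - F (IZR k' / INR n)) by ring. apply HO0; lra.
  - intros k. set (k' := (k mod Z.of_nat n)%Z). set (c := (k / Z.of_nat n)%Z).
    assert (Hk : IZR k = IZR k' + INR n * IZR c).
    { rewrite INR_IZR_INZ, <- mult_IZR, <- plus_IZR. f_equal. unfold k', c.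
      rewrite (Z.div_mod k (Z.of_nat n)) at 1; lia. }
    assert (Hsh : forall x, IZR k / INR n <= x <= (IZR k + 1) / INR n ->
      IZR k' / INR n <= x + IZR (- c) <= (IZR k' + 1) / INR n).
    { intros x Hx. rewrite opp_IZR.
      replace (IZR k' / INR n) with (IZR k / INR n - IZR c) by (rewrite Hk; field; lra).
      replace ((IZR k' + 1) / INR n) with ((IZR k + 1) / INR n - IZR c) by (rewrite Hk; field; lra).
      lra. }
    intros x y Hx Hy. apply Hsh in Hx, Hy.
    rewrite <- (per_IZR F Hper (- c) x), <- (per_IZR F Hper (- c) y).
    unfold Rabs. destruct (Rcase_abs _); [rewrite Ropp_minus_distr|]; auto.
  - generalize (Hsum t1 H1) (Hsum t2 H2). intros A1 A2.
    rewrite rsum_scal in A1, A2.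
    rewrite (rsum_ext _ (fun i => F (t1 (INR i / INR n) (INR (S i) / INR n))
                                - F (t2 (INR i / INR n) (INR (S i) / INR n)) + e)).
    + rewrite rsum_plus, rsum_minus, rsum_const.
      apply Rabs_lt_between in A1, A2.
      set (S1 := rsum (fun i => F (t1 _ _)) n) in *. set (S2 := rsum (fun i => F (t2 _ _)) n) in *.
      assert (A : / INR n * (S1 - S2) <= 2 * e) by lra.
      apply (Rmult_le_compat_l (INR n)) in A; [|lra].
      rewrite <- Rmult_assoc, Rinv_r in A by lra.
      replace (INR n * eps) with (INR n * (2 * e) + INR n * e) by (unfold e; field). lra.
    + intros i Hi. rewrite Z.mod_small by lia. unfold O0.
      now rewrite S_INR, <- INR_IZR_INZ.
Qed.

(* Fejer means sampled on a grid much finer than the cells: [P] uses the values of [F], [H] the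
   oscillations over the three cells around each grid point, plus the mass of the kernel far away. *)
Lemma trigonometric_sandwich F B eps : pri F -> (forall x, Rabs (F x) <= B) -> 0 < eps ->
  exists D P H, tp D P /\ tp D H /\ (forall x, Rabs (P x) <= B) /\
    (forall x, Rabs (F x - P x) <= H x) /\ mean H <= eps.
Proof.
  intros HF HB Heps.
  assert (HB0 : 0 <= B) by (apply Rle_trans with (2 := HB 0), Rabs_pos).
  (* The bound [o] adds the oscillations of three adjacent cells, so these contribute three times
     [eps / 6]; the other half of [eps] is left for the kernel tail. *)
  destruct (small_oscillation F (eps / 6) HF) as (n & O & Hn2 & HOper & HOpos & HO & HOsum); [lra|].
  assert (Hn : 2 <= INR n) by (apply (le_INR 2); exact Hn2).
  set (s := sin (PI / INR n)).
  generalize PI_RGT_0; intros Hpi.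
  assert (Hpn : 0 < PI / INR n <= PI / 2).
  { split; [apply Rdiv_lt_0_compat; lra|]. apply Rmult_le_compat_l; [lra|].
    apply Rinv_le_contravar; lra. }
  assert (Hs : 0 < s) by (apply sin_gt_0; lra).
  (* Chosen so that [2 * B * eta <= eps / 2]; the [+ 1] covers [B = 0]. *)
  set (eta := eps / (4 * (B + 1))).
  assert (Heta : 0 < eta) by (unfold eta; apply Rdiv_lt_0_compat; lra).
  destruct (archimed_cor1 (eta / (2 * (/ s * / s)))) as (N & HN & HN0).
  { assert (0 < / s) by now apply Rinv_0_lt_compat. apply Rdiv_lt_0_compat; [lra|nra]. }
  assert (Hfar : forall x, s <= Rabs (sin (PI * x)) -> fejer N x <= eta).
  { intros x Hx. eapply Rle_trans; [now apply (fejer_far N x s)|].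
    assert (Hs2 : 0 < 2 * (/ s * / s)).
    { assert (0 < / s) by now apply Rinv_0_lt_compat. nra. }
    apply (Rmult_lt_compat_r (2 * (/ s * / s))) in HN; [|exact Hs2].
    replace (eta / (2 * (/ s * / s)) * (2 * (/ s * / s))) with eta in HN by (field; lra). lra. }
  set (r := (N + N + 1)%nat). set (M := (n * r)%nat).
  assert (HMN : (N + N < M)%nat) by (unfold M, r; nia).
  assert (HM : 0 < INR M) by (apply lt_0_INR; lia).
  set (o := fun k : Z => O (k - 1)%Z + O k + O (k + 1)%Z).
  assert (Ho : forall k, 0 <= o k).
  { intros k. unfold o. generalize (HOpos (k - 1)%Z) (HOpos k) (HOpos (k + 1)%Z). lra. }
  set (cell := fun i => Z.of_nat (i / r)).
  set (w := fun i x => fejer N (x - INR i / INR M)).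
  assert (Hw0 : forall i x, 0 <= w i x) by (intros; apply fejer_nonneg; lia).
  assert (Hw1 : forall x, / INR M * rsum (fun i => w i x) M = 1).
  { intros x. unfold w. rewrite (tp_grid_average (N + N) (fejer N) M x HMN (tp_fejer N)).
    rewrite mean_fejer by lia. field. lra. }
  assert (Htw : forall i, tp (N + N) (w i)) by (intros; apply (tp_shift (N + N) (fejer N)), tp_fejer).
  assert (Hwm : forall i, mean (w i) = 1).
  { intros i. unfold w. rewrite (mean_shift_minus (fejer N)).
    - apply mean_fejer; lia.
    - eapply tp_pri, tp_fejer. }
  set (P := fun x => / INR M * rsum (fun i => F (INR i / INR M) * w i x) M).
  set (H := fun x => / INR M * rsum (fun i => o (cell i) * w i x) M + 2 * B * eta).
  assert (HiM : 0 < / INR M) by now apply Rinv_0_lt_compat.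
  assert (Hpt : forall i x, (i < M)%nat ->
    Rabs (F x - F (INR i / INR M)) * w i x <= o (cell i) * w i x + 2 * B * eta).
  { intros i x Hi. set (t := INR i / INR M).
    (* The integer [c] brings [u = x - c] within 1/2 of [t], where the distance on the circle is the
       ordinary one. *)
    set (c := up (x - t - / 2)). destruct (archimed (x - t - / 2)) as [Hc1 Hc2]. fold c in Hc1, Hc2.
    set (u := x + IZR (- c)).
    assert (Hu : u - t = x - t - IZR c) by (unfold u; rewrite opp_IZR; ring).
    assert (HFu : F x = F u) by (symmetry; apply per_IZR, HF).
    assert (Hwu : w i x = fejer N (u - t)).
    { unfold u. replace (x + IZR (- c) - t) with ((x - t) + IZR (- c)) by ring.
      symmetry. apply (per_IZR (fejer N)). apply (tp_pri _ _ (tp_fejer N)). }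
    assert (Hcell : INR n * t - 1 < IZR (cell i) <= INR n * t).
    { unfold cell, t, M. rewrite mult_INR, <- INR_IZR_INZ.
      assert (Hr : 0 < INR r) by (apply lt_0_INR; unfold r; lia).
      replace (INR n * (INR i / (INR n * INR r))) with (INR i / INR r) by (field; lra).
      assert (Hdm := Nat.div_mod_eq i r).
      assert (Hmod : (i mod r < r)%nat) by (apply Nat.mod_upper_bound; unfold r; lia).
      apply lt_INR in Hmod. generalize (pos_INR (i mod r)); intros Hm0.
      apply (f_equal INR) in Hdm. rewrite plus_INR, mult_INR in Hdm.
      rewrite Hdm.
      replace ((INR r * INR (i / r) + INR (i mod r)) / INR r)
        with (INR (i / r) + INR (i mod r) / INR r) by (field; lra).
      assert (0 <= INR (i mod r) / INR r < 1).
      { split; [apply Rdiv_le_0_compat; lra|].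
        apply Rmult_lt_reg_r with (INR r); [lra|]. unfold Rdiv.
        rewrite Rmult_assoc, Rinv_l by lra. lra. }
      lra. }
    (* In the near case [u] lies in the cell of [t] or in an adjacent one. In the far case the sine,
       increasing on [0, PI/2], exceeds [s], so the kernel is at most [eta]. *)
    destruct (Rle_or_lt (Rabs (u - t)) (/ INR n)) as [Hnear|Hnear].
    - assert (Hosc : Rabs (F x - F t) <= o (cell i)).
      { rewrite HFu. set (k := cell i) in *.
        assert (Hin : 0 < / INR n) by (apply Rinv_0_lt_compat; lra).
        apply Rabs_le_between in Hnear.
        assert (Hk : IZR k / INR n <= t < (IZR k + 1) / INR n).
        { split.
          - apply Rmult_le_reg_l with (INR n); [lra|].
            replace (INR n * (IZR k / INR n)) with (IZR k) by (field; lra). lra.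
          - apply Rmult_lt_reg_l with (INR n); [lra|].
            replace (INR n * ((IZR k + 1) / INR n)) with (IZR k + 1) by (field; lra). lra. }
        assert (E1 : (IZR k + 1) / INR n = IZR k / INR n + / INR n) by (field; lra).
        assert (Ht := HO k t (IZR k / INR n)).
        assert (Ht' := HO k t ((IZR k + 1) / INR n)).
        assert (E2 : IZR (k - 1) / INR n = IZR k / INR n - / INR n) by (rewrite minus_IZR; field; lra).
        assert (E3 : (IZR (k - 1) + 1) / INR n = IZR k / INR n) by (rewrite minus_IZR; field; lra).
        assert (E4 : IZR (k + 1) / INR n = IZR k / INR n + / INR n) by (rewrite plus_IZR; field; lra).
        assert (E5 : (IZR (k + 1) + 1) / INR n = IZR k / INR n + 2 * / INR n)
          by (rewrite plus_IZR; field; lra).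
        generalize (HOpos (k - 1)%Z) (HOpos k) (HOpos (k + 1)%Z); intros P1 P2 P3.
        unfold o.
        destruct (Rlt_or_le u (IZR k / INR n)) as [H1|H1];
          [|destruct (Rle_or_lt u ((IZR k + 1) / INR n)) as [H2|H2]].
        - replace (F u - F t) with ((F u - F (IZR k / INR n)) - (F t - F (IZR k / INR n))) by ring.
          eapply Rle_trans; [apply Rabs_triang|]. rewrite Rabs_Ropp.
          assert (Hl := HO (k - 1)%Z u (IZR k / INR n)).
          assert (Rabs (F u - F (IZR k / INR n)) <= O (k - 1)%Z) by (apply Hl; lra).
          assert (Rabs (F t - F (IZR k / INR n)) <= O k) by (apply Ht; lra). lra.
        - assert (Rabs (F u - F t) <= O k) by (apply HO; lra). lra.
        - replace (F u - F t) with ((F u - F ((IZR k + 1) / INR n)) - (F t - F ((IZR k + 1) / INR n))) by ring.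
          eapply Rle_trans; [apply Rabs_triang|]. rewrite Rabs_Ropp.
          assert (Hl := HO (k + 1)%Z u ((IZR k + 1) / INR n)).
          assert (Rabs (F u - F ((IZR k + 1) / INR n)) <= O (k + 1)%Z) by (apply Hl; lra).
          assert (Rabs (F t - F ((IZR k + 1) / INR n)) <= O k) by (apply Ht'; lra). lra. }
      apply Rle_trans with (o (cell i) * w i x); [apply Rmult_le_compat_r; auto|].
      assert (0 <= 2 * B * eta) by (apply Rmult_le_pos; lra). lra.
    - assert (Hws : w i x <= eta).
      { rewrite Hwu. apply Hfar. set (d := u - t) in *.
        assert (Hd : Rabs d <= / 2) by (apply Rabs_le; rewrite Hu; lra).
        assert (Hsd : Rabs (sin (PI * d)) = sin (PI * Rabs d)).
        { unfold Rabs at 2. destruct (Rcase_abs d) as [Hneg|Hpos].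
          - replace (PI * - d) with (- (PI * d)) by ring. rewrite sin_neg.
            rewrite Rabs_left1; [reflexivity|].
            assert (0 <= sin (- (PI * d))); [|rewrite sin_neg in *; lra].
            rewrite Rabs_left in Hd by assumption. apply sin_ge_0; nra.
          - apply Rabs_pos_eq. rewrite Rabs_right in Hd by assumption. apply sin_ge_0; nra. }
        rewrite Hsd. unfold s. generalize (Rabs_pos d); intros Hd0.
        apply Rlt_le, sin_increasing_1; [lra|lra|nra|nra|].
        apply Rmult_lt_compat_l; lra. }
      assert (Hdiff : Rabs (F x - F t) <= 2 * B).
      { eapply Rle_trans; [apply Rabs_triang|]. rewrite Rabs_Ropp.
        generalize (HB x) (HB t). lra. }
      apply Rle_trans with (2 * B * eta).
      + apply Rmult_le_compat; auto using Rabs_pos.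
      + assert (0 <= o (cell i) * w i x) by (apply Rmult_le_pos; auto). lra. }
  exists (N + N)%nat, P, H. split; [|split; [|split; [|split]]].
  - apply tp_scal, tp_rsum. intros i _. now apply tp_scal.
  - apply (tp_plus _ (fun x => / INR M * rsum (fun i => o (cell i) * w i x) M)); [|apply tp_const].
    apply tp_scal, tp_rsum. intros i _. now apply tp_scal.
  - intros x. unfold P. rewrite Rabs_mult, (Rabs_pos_eq (/ INR M)) by lra.
    rewrite <- (Rmult_1_r B), <- (Hw1 x), <- (Rmult_assoc B), (Rmult_comm B), Rmult_assoc.
    apply Rmult_le_compat_l; [lra|]. rewrite <- rsum_scal.
    eapply Rle_trans; [apply rsum_abs|]. apply rsum_le. intros i _.
    rewrite Rabs_mult, (Rabs_pos_eq (w i x)) by auto. now apply Rmult_le_compat_r.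
  - intros x.
    (* The grid weights at [x] average to exactly 1, so [F x] is itself a weighted average and the
       error is an average of differences. *)
    replace (F x - P x) with (/ INR M * rsum (fun i => (F x - F (INR i / INR M)) * w i x) M).
    + rewrite Rabs_mult, (Rabs_pos_eq (/ INR M)) by lra. unfold H.
      replace (2 * B * eta) with (/ INR M * rsum (fun _ => 2 * B * eta) M)
        by (rewrite rsum_const; field; lra).
      rewrite <- Rmult_plus_distr_l, <- rsum_plus.
      apply Rmult_le_compat_l; [lra|]. eapply Rle_trans; [apply rsum_abs|].
      apply rsum_le. intros i Hi. rewrite Rabs_mult, (Rabs_pos_eq (w i x)) by auto. now apply Hpt.
    + unfold P. rewrite (rsum_ext _ (fun i => F x * w i x - F (INR i / INR M) * w i x)) by (intros; ring).
      rewrite rsum_minus, rsum_scal, Rmult_minus_distr_l.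
      replace (/ INR M * (F x * rsum (fun i => w i x) M)) with (F x * (/ INR M * rsum (fun i => w i x) M)) by ring.
      rewrite Hw1. ring.
  - assert (Hpw : forall i, pri (w i)) by (intros; eapply tp_pri, Htw).
    unfold H. rewrite mean_plus, mean_const by (pri; auto).
    rewrite mean_scal by (pri; auto). rewrite (mean_rsum (fun i x => o (cell i) * w i x)) by (intros; (pri; auto)).
    (* Every weight has mean 1, so [mean H] reduces to a plain average of [o], in which each cell
       occurs [r] times. *)
    rewrite (rsum_ext _ (fun i => o (Z.of_nat (i / r)))).
    2: { intros i _. rewrite mean_scal, Hwm by auto. unfold cell. ring. }
    unfold M at 2. rewrite (rsum_blocks (fun k => o (Z.of_nat k))) by (unfold r; lia).
    unfold o. rewrite !rsum_plus.
    rewrite (rsum_ext _ (fun k => O (-1 + Z.of_nat k)%Z)) by (intros; f_equal; lia).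
    rewrite (rsum_ext (fun k => O (Z.of_nat k + 1)%Z) (fun k => O (1 + Z.of_nat k)%Z)) by (intros; f_equal; lia).
    rewrite !(periodic_window_sum O n HOper).
    set (S := rsum _ n) in *. unfold M. rewrite mult_INR.
    assert (Hr : 0 < INR r) by (apply lt_0_INR; unfold r; lia).
    replace (/ (INR n * INR r) * (INR r * (S + S + S))) with (/ INR n * (3 * S)) by (field; lra).
    assert (/ INR n * (3 * S) <= eps / 2).
    { apply Rmult_le_reg_l with (INR n); [lra|].
      rewrite <- Rmult_assoc, Rinv_r, Rmult_1_l by lra. lra. }
    assert (2 * B * eta <= eps / 2).
    { unfold eta. apply Rmult_le_reg_r with (4 * (B + 1)); [lra|].
      replace (2 * B * (eps / (4 * (B + 1))) * (4 * (B + 1))) with (2 * B * eps) by (field; lra). nra. }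
    lra.
Qed.

(** * Autocorrelation of return times *)

Definition corr (g h : R -> R) (s : R) : R := mean (fun x => g x * h (x - s)).

Lemma sumZ_rsum u n : sumZ u n = rsum (fun k => u (Z.of_nat k - Z.of_nat n)%Z) (2 * n + 1).
Proof.
  unfold sumZ. generalize (2 * n)%nat. intros m.
  replace (m + 1)%nat with (S m) by lia.
  induction m as [|m IH]; [simpl; ring|]. rewrite tech5, IH. reflexivity.
Qed.

Lemma rsum_below_le m L : rsum (fun k => if (k <? m)%nat then 1 else 0) L <= INR m.
Proof.
  apply Rle_trans with (INR (Nat.min L m)); [|apply le_INR; lia].
  induction L as [|L IH]; simpl rsum; [simpl; lra|].
  destruct (Nat.ltb_spec L m).
  - replace (Nat.min (S L) m) with (S (Nat.min L m)) by lia. rewrite S_INR. lra.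
  - replace (Nat.min (S L) m) with (Nat.min L m) by lia. lra.
Qed.

Lemma rsum_above_le m L : rsum (fun k => if (L <=? k + m)%nat then 1 else 0) L <= INR m.
Proof.
  enough (H : forall K, rsum (fun k => if (L <=? k + m)%nat then 1 else 0) K <= INR (K + m - L)).
  { eapply Rle_trans; [apply H|]. apply le_INR; lia. }
  induction K as [|K IH]; simpl rsum; [apply pos_INR|].
  destruct (Nat.leb_spec L (K + m)).
  - replace (S K + m - L)%nat with (S (K + m - L)) by lia. rewrite S_INR. lra.
  - apply Rle_trans with (INR (K + m - L) + 0); [lra|]. rewrite Rplus_0_r. apply le_INR; lia.
Qed.

Lemma INR_2n1_pos n : 0 < INR (2 * n + 1).
Proof. apply lt_0_INR. lia. Qed.

(** The truncation removes only indices among the first or the last [|z|] of the window, and each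
    removed product is at most [B * B]. *)
Lemma autocorr_boundary w B n z : (forall a, Rabs (w a) <= B) ->
  Rabs (autocorr_approx w n z - / INR (2 * n + 1) * sumZ (fun a => w a * w (a - z)%Z) n)
  <= / INR (2 * n + 1) * (B * B * (2 * INR (Z.abs_nat z))).
Proof.
  intros HB. assert (HB0 : 0 <= B) by (apply Rle_trans with (2 := HB 0%Z), Rabs_pos).
  unfold autocorr_approx. rewrite <- Rmult_minus_distr_l, Rabs_mult.
  assert (Hi : 0 < / INR (2 * n + 1)) by apply Rinv_0_lt_compat, INR_2n1_pos.
  rewrite (Rabs_pos_eq (/ _)) by lra. apply Rmult_le_compat_l; [lra|].
  rewrite !sumZ_rsum, <- rsum_minus.
  eapply Rle_trans; [apply rsum_abs|].
  set (m := Z.abs_nat z). set (L := (2 * n + 1)%nat).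
  apply Rle_trans with (rsum (fun k => B * B * ((if (k <? m)%nat then 1 else 0)
                                     + (if (L <=? k + m)%nat then 1 else 0))) L).
  - apply rsum_le. intros k Hk. set (a := (Z.of_nat k - Z.of_nat n)%Z).
    destruct (Z.leb_spec (Z.abs (a - z)) (Z.of_nat n)) as [H|H].
    + replace (_ - _) with 0 by ring. rewrite Rabs_R0. apply Rmult_le_pos; [nra|].
      destruct (_ <? _)%nat, (_ <=? _)%nat; lra.
    + assert (Hc : 1 <= (if (k <? m)%nat then 1 else 0) + (if (L <=? k + m)%nat then 1 else 0)).
      { destruct (Nat.ltb_spec k m), (Nat.leb_spec L (k + m)); try lra.
        exfalso. unfold a, m, L in *. lia. }
      assert (Hw : Rabs (0 - w a * w (a - z)%Z) <= B * B).
      { rewrite Rminus_0_l, Rabs_Ropp, Rabs_mult. apply Rmult_le_compat; auto using Rabs_pos. }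
      assert (0 <= B * B) by nra. nra.
  - rewrite rsum_scal, rsum_plus. apply Rmult_le_compat_l; [nra|].
    generalize (rsum_below_le m L) (rsum_above_le m L). lra.
Qed.

Lemma eventually_small (C e : R) : 0 < e ->
  exists N : nat, forall n, (N <= n)%nat -> / INR (2 * n + 1) * C <= e.
Proof.
  intros He. destruct (Rle_or_lt C 0) as [HC|HC].
  - exists 0%nat. intros n _.
    assert (0 < / INR (2 * n + 1)) by apply Rinv_0_lt_compat, INR_2n1_pos. nra.
  - destruct (archimed_cor1 (e / C)) as (N & HN & HN0); [now apply Rdiv_lt_0_compat|].
    exists N. intros n Hn.
    apply Rle_trans with (/ INR N * C).
    + apply Rmult_le_compat_r; [lra|]. apply Rinv_le_contravar; [now apply lt_0_INR|].
      apply le_INR; lia.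
    + apply (Rmult_lt_compat_r C) in HN; [|exact HC].
      replace (e / C * C) with e in HN by (field; lra). lra.
Qed.

(** The two factors are exchanged one at a time. Each exchange costs [B] times a translate of [H],
    and translation keeps the mean. *)
Lemma corr_stable f g H e B s : pri f -> pri g -> pri H ->
  (forall x, Rabs (f x) <= B) -> (forall x, Rabs (g x) <= B) ->
  (forall x, Rabs (f x - g x) <= H x) -> mean H <= e ->
  Rabs (corr f f s - corr g g s) <= 2 * B * e.
Proof.
  intros Hf Hg Hp Bf Bg Hd Hm.
  assert (HB0 : 0 <= B) by (apply Rle_trans with (2 := Bf 0), Rabs_pos).
  unfold corr. rewrite <- mean_minus by pri.
  apply Rle_trans with (mean (fun x => B * (H (x - s) + H x))).
  - apply mean_abs_le; [pri..|]. intros x.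
    replace (f x * f (x - s) - g x * g (x - s)) with
      (f x * (f (x - s) - g (x - s)) + g (x - s) * (f x - g x)) by ring.
    eapply Rle_trans; [apply Rabs_triang|]. rewrite !Rabs_mult, Rmult_plus_distr_l.
    apply Rplus_le_compat; apply Rmult_le_compat; auto using Rabs_pos.
  - rewrite mean_scal, mean_plus, mean_shift_minus by pri. nra.
Qed.

(** [D] and [d] are fixed before [G], [beta], [s] and [y], so one choice serves all large [i] at
    once; only [N] depends on the particular orbit. *)
Lemma autocorr_near F B z : pri F -> (forall x, Rabs (F x) <= B) ->
  forall eps, 0 < eps -> exists D d, 0 < d /\
    forall G beta s y, (forall x, Rabs (G x - F x) <= d) -> nonresonant D beta ->
      Rabs (IZR z * beta - s) <= d ->
      exists N : nat, forall n, (N <= n)%nat ->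
        Rabs (autocorr_approx (fun a => G (y + IZR a * beta)) n z - corr F F s) <= eps.
Proof.
  intros HF HB eps Heps.
  assert (HB0 : 0 <= B) by (apply Rle_trans with (2 := HB 0), Rabs_pos).
  (* The errors proportional to [e] add up to [4 * (B + 1) + 1 + 2 * B = 6 * B + 5] times [e], which
     is [eps / 2]. The other half absorbs the terms divided by the window length. *)
  set (e := eps / (2 * (6 * B + 5))).
  assert (He : 0 < e) by (unfold e; apply Rdiv_lt_0_compat; lra).
  destruct (trigonometric_sandwich F B e HF HB He) as (D & P & H & HP & HH & HPB & HFP & HHm).
  destruct (tp_lipschitz D P HP) as (L & HL & HPL).
  (* The three bounds serve in turn: [|G| <= B + 1], a uniform error of at most [e], and a change of
     shift in [P] that costs at most [e]. *)
  set (d := Rmin 1 (Rmin e (e / (B * L + 1)))).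
  assert (HBL : 0 <= B * L) by now apply Rmult_le_pos.
  assert (Hd : 0 < d).
  { unfold d. apply Rmin_pos; [lra|]. apply Rmin_pos; [lra|]. apply Rdiv_lt_0_compat; lra. }
  assert (Hd1 : d <= 1) by apply Rmin_l.
  assert (Hde : d <= e) by (eapply Rle_trans; [apply Rmin_r|apply Rmin_l]).
  assert (HdL : B * L * d <= e).
  { assert (Hd2 : d <= e / (B * L + 1)) by (eapply Rle_trans; [apply Rmin_r|apply Rmin_r]).
    apply (Rmult_le_compat_r (B * L + 1)) in Hd2; [|lra].
    replace (e / (B * L + 1) * (B * L + 1)) with e in Hd2 by (field; lra). nra. }
  exists (D + D)%nat, d. split; [exact Hd|].
  intros G beta s y HG Hbeta Hs. set (t := IZR z * beta) in *.
  (* [Q] replaces the product of two weights, and [K] majorises the error up to a factor and a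
     constant. Both have degree at most [D + D], so both average along the orbit. *)
  set (Q := fun x => P x * P (x - t)). set (K := fun x => H x + H (x - t)).
  assert (HQ : tp (D + D) Q) by (apply tp_mult; [|apply tp_shift]; assumption).
  assert (HK : tp (D + D) K).
  { apply tp_mono with D; [lia|]. apply (tp_plus D H (fun x => H (x - t))); [|apply tp_shift]; assumption. }
  assert (HpP := tp_pri _ _ HP). assert (HpH := tp_pri _ _ HH).
  assert (HpQ := tp_pri _ _ HQ). assert (HpK := tp_pri _ _ HK).
  destruct (tp_orbit_average _ Q beta Hbeta HQ) as [CQ HCQ].
  destruct (tp_orbit_average _ K beta Hbeta HK) as [CK HCK].
  assert (HKm : mean K <= 2 * e).
  { unfold K. rewrite mean_plus, mean_shift_minus by pri. lra. }
  assert (HGB : forall x, Rabs (G x) <= B + 1).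
  { intros x. replace (G x) with ((G x - F x) + F x) by ring.
    eapply Rle_trans; [apply Rabs_triang|]. generalize (HG x) (HB x). lra. }
  assert (HGP : forall x, Rabs (G x - P x) <= d + H x).
  { intros x. replace (G x - P x) with ((G x - F x) + (F x - P x)) by ring.
    eapply Rle_trans; [apply Rabs_triang|]. generalize (HG x) (HFP x). lra. }
  assert (HGQ : forall x, Rabs (G x * G (x - t) - Q x) <= (B + 1) * (2 * d + K x)).
  { intros x. unfold Q, K.
    replace (G x * G (x - t) - P x * P (x - t)) with
      (G x * (G (x - t) - P (x - t)) + P (x - t) * (G x - P x)) by ring.
    eapply Rle_trans; [apply Rabs_triang|]. rewrite !Rabs_mult.
    apply Rle_trans with ((B + 1) * (d + H (x - t)) + (B + 1) * (d + H x)); [|lra].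
    apply Rplus_le_compat; apply Rmult_le_compat; auto using Rabs_pos.
    specialize (HPB (x - t)). lra. }
  (* Passing from shift [t] to [s] uses the Lipschitz constant of [P]; passing from [P] back to [F]
     uses [corr_stable]. *)
  assert (HQm : Rabs (mean Q - corr F F s) <= e + 2 * B * e).
  { replace (mean Q - corr F F s) with ((mean Q - corr P P s) + - (corr F F s - corr P P s)) by ring.
    eapply Rle_trans; [apply Rabs_triang|]. rewrite Rabs_Ropp. apply Rplus_le_compat.
    - unfold corr, Q. rewrite <- mean_minus by pri.
      rewrite <- (mean_const e). apply mean_abs_le; [pri..|]. intros x.
      rewrite <- Rmult_minus_distr_l, Rabs_mult.
      apply Rle_trans with (B * (L * Rabs (t - s))).
      + apply Rmult_le_compat; auto using Rabs_pos.
        rewrite (Rabs_minus_sym t s). replace (s - t) with (x - t - (x - s)) by ring. apply HPL.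
      + rewrite <- Rmult_assoc. apply Rle_trans with (2 := HdL). now apply Rmult_le_compat_l.
    - now apply corr_stable with H. }
  destruct (eventually_small ((B + 1) * (B + 1) * (2 * INR (Z.abs_nat z)) + (B + 1) * CK + CQ)
              (eps / 2)) as [N HN]; [lra|].
  exists N. intros n Hn. specialize (HN n Hn).
  set (w := fun a => G (y + IZR a * beta)).
  assert (Hb := autocorr_boundary w (B + 1) n z (fun a => HGB _)).
  assert (Hi : 0 < / INR (2 * n + 1)) by apply Rinv_0_lt_compat, INR_2n1_pos.
  set (y' := y - INR n * beta).
  assert (E : forall k : nat, y + IZR (Z.of_nat k - Z.of_nat n) * beta = y' + INR k * beta).
  { intros k. unfold y'. rewrite minus_IZR, <- !INR_IZR_INZ. ring. }
  assert (Hw : sumZ (fun a => w a * w (a - z)%Z) n =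
    rsum (fun k => G (y' + INR k * beta) * G (y' + INR k * beta - t)) (2 * n + 1)).
  { rewrite sumZ_rsum. apply rsum_ext. intros k _. unfold w. rewrite <- E. do 2 f_equal.
    unfold t. rewrite !minus_IZR. ring. }
  rewrite Hw in Hb. specialize (HCQ y' (2 * n + 1)%nat). specialize (HCK y' (2 * n + 1)%nat).
  set (M := (2 * n + 1)%nat) in *.
  set (SG := rsum (fun k => G (y' + INR k * beta) * G (y' + INR k * beta - t)) M) in *.
  set (SQ := rsum (fun k => Q (y' + INR k * beta)) M) in *.
  set (SK := rsum (fun k => K (y' + INR k * beta)) M) in *.
  assert (H1 : Rabs (SG - SQ) <= (B + 1) * (2 * d * INR M + SK)).
  { unfold SG, SQ, SK. rewrite <- rsum_minus. eapply Rle_trans; [apply rsum_abs|].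
    apply Rle_trans with (rsum (fun k => (B + 1) * (2 * d + K (y' + INR k * beta))) M).
    - apply rsum_le. intros k _. apply HGQ.
    - rewrite rsum_scal, rsum_plus, rsum_const. right. ring. }
  assert (HM : 0 < INR M) by apply INR_2n1_pos.
  assert (H2 : Rabs (/ INR M * SG - mean Q) <= (B + 1) * (4 * e) + / INR M * ((B + 1) * CK + CQ)).
  { replace (/ INR M * SG - mean Q) with (/ INR M * ((SG - SQ) + (SQ - INR M * mean Q))) by (field; lra).
    rewrite Rabs_mult, (Rabs_pos_eq (/ INR M)) by lra.
    replace ((B + 1) * (4 * e) + / INR M * ((B + 1) * CK + CQ)) with
      (/ INR M * ((B + 1) * (4 * e * INR M + CK) + CQ)) by (field; lra).
    apply Rmult_le_compat_l; [lra|]. eapply Rle_trans; [apply Rabs_triang|].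
    apply Rplus_le_compat; [|exact HCQ]. eapply Rle_trans; [exact H1|].
    apply Rmult_le_compat_l; [lra|]. apply Rabs_le_between in HCK.
    assert (INR M * mean K <= INR M * (2 * e)) by (apply Rmult_le_compat_l; lra). nra. }
  replace (autocorr_approx w n z - corr F F s) with
    ((autocorr_approx w n z - / INR M * SG) + (/ INR M * SG - mean Q) + (mean Q - corr F F s)) by ring.
  eapply Rle_trans; [apply Rabs_triang|].
  eapply Rle_trans; [apply Rplus_le_compat_r, Rabs_triang|].
  assert (Hee : (6 * B + 5) * e = eps / 2) by (unfold e; field; lra).
  nra.
Qed.

(** The window splits into whole periods, each with sum [S] wherever it starts, and a remainder
    shorter than [q], which the division by the window length makes negligible. *)
Lemma periodic_average_cv (u : Z -> R) (q : nat) : (0 < q)%nat ->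
  (forall k, u (k + Z.of_nat q)%Z = u k) ->
  exists l, Un_cv (fun n => / INR (2 * n + 1) * sumZ u n) l.
Proof.
  intros Hq Hu. set (S := rsum (fun k => u (Z.of_nat k)) q).
  assert (Hq0 : 0 < INR q) by now apply lt_0_INR.
  assert (Hblocks : forall t s, rsum (fun k => u (s + Z.of_nat k)%Z) (t * q) = INR t * S).
  { induction t as [|t IH]; intros s; [simpl; ring|].
    replace (Datatypes.S t * q)%nat with (t * q + q)%nat by lia.
    rewrite rsum_app, IH, S_INR.
    rewrite (rsum_ext _ (fun k => u (s + Z.of_nat (t * q) + Z.of_nat k)%Z)) by (intros; f_equal; lia).
    rewrite (periodic_window_sum u q Hu). fold S. ring. }
  (* The sum of absolute values over one period bounds every value, since a period may be taken to
     start at any index. *)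
  set (A := rsum (fun k => Rabs (u (Z.of_nat k))) q).
  assert (HuA : forall a, Rabs (u a) <= A).
  { intros a.
    assert (HA : rsum (fun k => Rabs (u (a + Z.of_nat k)%Z)) q = A).
    { apply (periodic_window_sum (fun k => Rabs (u k))). intros k. now rewrite Hu. }
    rewrite <- HA. destruct q as [|q]; [lia|]. rewrite rsum_first, Z.add_0_r.
    generalize (rsum_nonneg (fun k => Rabs (u (a + Z.of_nat (Datatypes.S k))%Z)) q).
    intros Hn. assert (0 <= rsum (fun k => Rabs (u (a + Z.of_nat (Datatypes.S k))%Z)) q); [|lra].
    apply Hn. intros; apply Rabs_pos. }
  assert (HA0 : 0 <= A) by (apply Rle_trans with (2 := HuA 0%Z), Rabs_pos).
  exists (S / INR q). intros e He.
  destruct (eventually_small (INR q * A + Rabs S) (e / 2)) as [N HN]; [lra|].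
  exists N. intros n Hn. specialize (HN n ltac:(lia)).
  unfold Rdist. apply Rle_lt_trans with (e / 2); [|lra]. eapply Rle_trans; [|exact HN].
  assert (HM := INR_2n1_pos n). rewrite sumZ_rsum.
  set (M := (2 * n + 1)%nat) in *.
  rewrite (rsum_ext _ (fun k => u (- Z.of_nat n + Z.of_nat k)%Z)) by (intros; f_equal; lia).
  assert (HMq := Nat.div_mod_eq M q).
  assert (Hr : (M mod q < q)%nat) by (apply Nat.mod_upper_bound; lia).
  set (t := (M / q)%nat) in *. set (r := (M mod q)%nat) in *.
  rewrite HMq at 2. rewrite (Nat.mul_comm q t), rsum_app, Hblocks.
  set (X := rsum _ r).
  assert (HX : Rabs X <= INR q * A).
  { unfold X. eapply Rle_trans; [apply rsum_abs|].
    apply Rle_trans with (rsum (fun _ => A) r); [apply rsum_le; auto|].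
    rewrite rsum_const. apply Rmult_le_compat_r; [exact HA0|]. apply le_INR; lia. }
  assert (HM' : INR M = INR q * INR t + INR r) by (rewrite <- mult_INR, <- plus_INR; now f_equal).
  replace (/ INR M * (INR t * S + X) - S / INR q) with (/ INR M * (X - INR r / INR q * S))
    by (rewrite HM' in *; field; lra).
  rewrite Rabs_mult, Rabs_pos_eq by (left; now apply Rinv_0_lt_compat).
  apply Rmult_le_compat_l; [left; now apply Rinv_0_lt_compat|].
  eapply Rle_trans; [apply Rabs_triang|]. rewrite Rabs_Ropp, Rabs_mult.
  apply Rplus_le_compat; [exact HX|].
  rewrite <- (Rmult_1_l (Rabs S)) at 2. apply Rmult_le_compat_r; [apply Rabs_pos|].
  assert (INR r <= INR q) by (apply le_INR; lia).
  rewrite Rabs_pos_eq.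
  - apply Rmult_le_reg_r with (INR q); [exact Hq0|]. unfold Rdiv.
    rewrite Rmult_assoc, Rinv_l by lra. lra.
  - apply Rdiv_le_0_compat; [apply pos_INR|exact Hq0].
Qed.

Lemma rational_or_nonresonant beta :
  (exists (q : nat) (p : Z), (0 < q)%nat /\ INR q * beta = IZR p) \/
  (forall D, nonresonant D beta).
Proof.
  destruct (classic (exists (q : nat) (p : Z), (0 < q)%nat /\ INR q * beta = IZR p)) as [H|H];
    [now left|]. right. intros D m Hm H0. apply H.
  apply sin_eq_0_0 in H0. destruct H0 as [k Hk].
  assert (Hmk : IZR m * beta = IZR k).
  { apply Rmult_eq_reg_l with PI; [lra|]. apply PI_neq0. }
  destruct (Z.le_gt_cases 0 m) as [Hs|Hs].
  - exists (Z.to_nat m), k. split; [lia|]. now rewrite INR_IZR_INZ, Z2Nat.id.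
  - exists (Z.to_nat (- m)), (- k)%Z. split; [lia|].
    rewrite INR_IZR_INZ, Z2Nat.id, !opp_IZR by lia. lra.
Qed.

(** Going from [D] to [S D] adds only the frequencies of modulus [S D]. If [S D] times [alpha] is an
    integer, a resonant [betas i] within [1 / (S D)] of [alpha] would give an integer less than 1
    away, hence the same one, and [betas i = alpha]. Otherwise continuity of the sine suffices. *)
Lemma eventually_nonresonant (betas : nat -> R) alpha : Un_cv betas alpha ->
  (forall i, betas i <> alpha) ->
  forall D, exists N : nat, forall i, (N <= i)%nat -> nonresonant D (betas i).
Proof.
  intros Hcv Hne. induction D as [|D [N1 IH]].
  - exists 0%nat. intros i _ m Hm. lia.
  - set (c := PI * IZR (Z.of_nat (S D))).
    assert (H : exists N2 : nat, forall i, (N2 <= i)%nat -> sin (c * betas i) <> 0).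
    { destruct (Req_dec (sin (c * alpha)) 0) as [H0|H0].
      - destruct (Hcv (/ IZR (Z.of_nat (S D)))) as [N2 HN2].
        { apply Rinv_0_lt_compat, IZR_lt. lia. }
        exists N2. intros i Hi Hsin. specialize (HN2 i Hi). unfold Rdist in HN2.
        apply sin_eq_0_0 in H0, Hsin. destruct H0 as [k Hk], Hsin as [k' Hk'].
        unfold c in *. assert (Hpi := PI_RGT_0).
        assert (HS : 0 < IZR (Z.of_nat (S D))) by (apply IZR_lt; lia).
        assert (E : IZR (Z.of_nat (S D)) * alpha = IZR k) by (apply Rmult_eq_reg_l with PI; lra).
        assert (E' : IZR (Z.of_nat (S D)) * betas i = IZR k') by (apply Rmult_eq_reg_l with PI; lra).
        assert (Hlt : Rabs (IZR (k' - k)) < 1).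
        { rewrite minus_IZR, <- E, <- E', <- Rmult_minus_distr_l, Rabs_mult, (Rabs_pos_eq (IZR _)) by lra.
          apply (Rmult_lt_compat_l (IZR (Z.of_nat (S D)))) in HN2; [|exact HS].
          rewrite Rinv_r in HN2; lra. }
        rewrite Rabs_Zabs in Hlt. apply lt_IZR in Hlt.
        assert (k' = k) by lia. subst k'.
        apply (Hne i). apply Rmult_eq_reg_l with (IZR (Z.of_nat (S D))); lra.
      - assert (Hs : Un_cv (fun i => sin (c * betas i)) (sin (c * alpha))).
        { apply (continuity_seq (fun x => sin (c * x))); [|exact Hcv]. reg. }
        destruct (Hs _ (Rabs_pos_lt _ H0)) as [N2 HN2]. exists N2. intros i Hi Hz.
        specialize (HN2 i Hi). unfold Rdist in HN2. rewrite Hz, Rminus_0_l, Rabs_Ropp in HN2. lra. }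
    destruct H as [N2 H]. exists (Nat.max N1 N2). intros i Hi m Hm.
    destruct (Z.le_gt_cases (Z.abs m) (Z.of_nat D)) as [Hd|Hd]; [apply IH; lia|].
    specialize (H i ltac:(lia)). unfold c in H.
    destruct (Z.abs_eq_or_opp m) as [Ha|Ha].
    + replace m with (Z.of_nat (S D)) by lia. exact H.
    + replace m with (- Z.of_nat (S D))%Z by lia. intros H0. apply H.
      rewrite opp_IZR in H0.
      replace (PI * - IZR (Z.of_nat (S D)) * betas i) with
        (- (PI * IZR (Z.of_nat (S D)) * betas i)) in H0 by ring.
      rewrite sin_neg in H0. lra.
Qed.

(** In the rational case the limit may depend on [y], so only its existence is claimed. In the other
    case [autocorr_near] applies with [G = F] and the exact shift. *)
Lemma autocorrelation_exists F beta y z : pri F ->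
  exists l, Un_cv (fun n => autocorr_approx (fun a => F (y + IZR a * beta)) n z) l.
Proof.
  intros HF. destruct (pri_bounded F HF) as (B & HB0 & HB).
  destruct (rational_or_nonresonant beta) as [(q & p & Hq & Hp)|Hb].
  - set (w := fun a => F (y + IZR a * beta)).
    assert (Hw : forall a, w (a + Z.of_nat q)%Z = w a).
    { intros a. unfold w. rewrite plus_IZR, <- INR_IZR_INZ.
      replace (y + (IZR a + INR q) * beta) with (y + IZR a * beta + INR q * beta) by ring.
      rewrite Hp. apply per_IZR, HF. }
    destruct (periodic_average_cv (fun a => w a * w (a - z)%Z) q Hq) as [l Hl].
    { intros k. rewrite Hw. replace (k + Z.of_nat q - z)%Z with (k - z + Z.of_nat q)%Z by lia.
      now rewrite Hw. }
    exists l. intros e He. destruct (Hl (e / 2)) as [N1 HN1]; [lra|].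
    destruct (eventually_small (B * B * (2 * INR (Z.abs_nat z))) (e / 4)) as [N2 HN2]; [lra|].
    exists (Nat.max N1 N2). intros n Hn. specialize (HN1 n ltac:(lia)). specialize (HN2 n ltac:(lia)).
    assert (Hbd := autocorr_boundary w B n z (fun a => HB _)).
    unfold Rdist in *. apply Rabs_lt_between in HN1. apply Rabs_le_between in Hbd.
    apply Rabs_lt_between. lra.
  - exists (corr F F (IZR z * beta)). intros e He.
    destruct (autocorr_near F B z HF HB (e / 2)) as (D & d & Hd & H); [lra|].
    destruct (H F beta (IZR z * beta) y) as [N HN].
    + intros x. rewrite Rminus_diag, Rabs_R0. lra.
    + apply Hb.
    + rewrite Rminus_diag, Rabs_R0. lra.
    + exists N. intros n Hn. specialize (HN n Hn). unfold Rdist. lra.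
Qed.

(** * Fourier expansion of correlations *)

Lemma sumZ_ext u v N : (forall m, u m = v m) -> sumZ u N = sumZ v N.
Proof. intros H. rewrite !sumZ_rsum. apply rsum_ext. auto. Qed.

Lemma sumZ_le u v N : (forall m, u m <= v m) -> sumZ u N <= sumZ v N.
Proof. intros H. rewrite !sumZ_rsum. apply rsum_le. auto. Qed.

Lemma sumZ_plus u v N : sumZ (fun m => u m + v m) N = sumZ u N + sumZ v N.
Proof. rewrite !sumZ_rsum. apply rsum_plus. Qed.

Lemma sumZ_minus u v N : sumZ (fun m => u m - v m) N = sumZ u N - sumZ v N.
Proof. rewrite !sumZ_rsum. apply rsum_minus. Qed.

Lemma sumZ_scal c u N : sumZ (fun m => c * u m) N = c * sumZ u N.
Proof. rewrite !sumZ_rsum. apply rsum_scal. Qed.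

Lemma sumZ_abs u N : Rabs (sumZ u N) <= sumZ (fun m => Rabs (u m)) N.
Proof. rewrite !sumZ_rsum. apply rsum_abs. Qed.

Lemma sumZ_swap (u : Z -> Z -> R) N M :
  sumZ (fun m => sumZ (u m) M) N = sumZ (fun k => sumZ (fun m => u m k) N) M.
Proof.
  rewrite !sumZ_rsum.
  rewrite (rsum_ext _ _ _ (fun k _ => sumZ_rsum (u (Z.of_nat k - Z.of_nat N)%Z) M)).
  rewrite rsum_swap. apply rsum_ext. intros k _. now rewrite sumZ_rsum.
Qed.

Lemma sumZ_pick u N k : (Z.abs k <= Z.of_nat N)%Z ->
  sumZ (fun m => if Z.eqb m k then u m else 0) N = u k.
Proof.
  intros Hk. rewrite sumZ_rsum.
  rewrite (rsum_ext _ (fun j => if Nat.eqb j (Z.to_nat (k + Z.of_nat N))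
                                then u (Z.of_nat j - Z.of_nat N)%Z else 0)).
  - rewrite rsum_pick by lia. f_equal. lia.
  - intros j _.
    destruct (Z.eqb_spec (Z.of_nat j - Z.of_nat N) k), (Nat.eqb_spec j (Z.to_nat (k + Z.of_nat N)));
      auto; lia.
Qed.

Lemma sumZ_S u N : sumZ u (S N) = u (- Z.of_nat (S N))%Z + sumZ u N + u (Z.of_nat (S N)).
Proof.
  rewrite !sumZ_rsum. replace (2 * S N + 1)%nat with (S (S (2 * N + 1))) by lia.
  rewrite rsum_first. cbn [rsum].
  rewrite (rsum_ext _ (fun k => u (Z.of_nat k - Z.of_nat N)%Z)) by (intros; f_equal; lia).
  replace (Z.of_nat 0 - Z.of_nat (S N))%Z with (- Z.of_nat (S N))%Z by lia.
  replace (Z.of_nat (S (2 * N + 1)) - Z.of_nat (S N))%Z with (Z.of_nat (S N)) by lia.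
  ring.
Qed.

Lemma sumZ_odd u N : (forall m, u (- m)%Z = - u m) -> sumZ u N = 0.
Proof.
  intros H. induction N as [|N IH].
  - unfold sumZ; simpl. specialize (H 0%Z). simpl in H. lra.
  - rewrite sumZ_S, IH, H. ring.
Qed.

(** Symmetric partial sums of a nonnegative sequence increase, and [u] is the difference of the
    nonnegative sequences [u + |u|] and [|u|]. *)
Lemma sumZ_abs_cv u B : (forall N, sumZ (fun m => Rabs (u m)) N <= B) ->
  exists l, Un_cv (sumZ u) l.
Proof.
  assert (Hpos : forall v, (forall m, 0 <= v m) -> (exists C, forall N, sumZ v N <= C) ->
    exists l, Un_cv (sumZ v) l).
  { intros v Hv [C HC]. destruct (growing_cv (sumZ v)) as [l Hl].
    - intros N. rewrite sumZ_S. generalize (Hv (- Z.of_nat (S N))%Z) (Hv (Z.of_nat (S N))). lra.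
    - exists C. intros x [N ->]. apply HC.
    - now exists l. }
  intros HB.
  destruct (Hpos (fun m => Rabs (u m))) as [l1 H1]; [intros; apply Rabs_pos|now exists B|].
  destruct (Hpos (fun m => u m + Rabs (u m))) as [l2 H2].
  - intros m. generalize (Rle_abs (- u m)). rewrite Rabs_Ropp. lra.
  - exists (B + B). intros N. rewrite sumZ_plus. specialize (HB N).
    generalize (Rle_abs (sumZ u N)) (sumZ_abs u N). lra.
  - exists (l2 - l1). intros e He. destruct (CV_minus _ _ _ _ H2 H1 e He) as [N HN].
    exists N. intros n Hn. specialize (HN n Hn). revert HN.
    unfold Rdist. rewrite sumZ_plus. apply Rle_lt_trans. right. f_equal. ring.
Qed.

(** * Fourier partial sums and their mean-square convergence *)

Lemma tp_sumZ D (F : Z -> R -> R) N :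
  (forall m, (Z.abs m <= Z.of_nat N)%Z -> tp D (F m)) -> tp D (fun x => sumZ (fun m => F m x) N).
Proof.
  intros H. apply tp_ext with (fun x => rsum (fun k => F (Z.of_nat k - Z.of_nat N)%Z x) (2 * N + 1)).
  - intros x. now rewrite sumZ_rsum.
  - apply (tp_rsum D (fun k => F (Z.of_nat k - Z.of_nat N)%Z)). intros k Hk. apply H. lia.
Qed.

Lemma mean_sumZ (F : Z -> R -> R) N : (forall m, pri (F m)) ->
  mean (fun x => sumZ (fun m => F m x) N) = sumZ (fun m => mean (F m)) N.
Proof.
  intros H. rewrite sumZ_rsum.
  rewrite (mean_ext _ (fun x => rsum (fun k => F (Z.of_nat k - Z.of_nat N)%Z x) (2 * N + 1)))
    by (intros; apply sumZ_rsum).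
  apply (mean_rsum (fun k => F (Z.of_nat k - Z.of_nat N)%Z)). auto.
Qed.

(** For real [g] the Fourier coefficient at [m] is [ca g m - i * cb g m]. *)
Definition ca (g : R -> R) (m : Z) : R := mean (fun x => g x * cos (2 * PI * IZR m * x)).
Definition cb (g : R -> R) (m : Z) : R := mean (fun x => g x * sin (2 * PI * IZR m * x)).

(** The real part of the symmetric sum of [(u m - i * v m) exp(2 pi i m x)]. With [u] even and [v]
    odd, the imaginary part cancels between [m] and [-m]. *)
Definition tsum (u v : Z -> R) (N : nat) (x : R) : R :=
  sumZ (fun m => u m * cos (2 * PI * IZR m * x) + v m * sin (2 * PI * IZR m * x)) N.

Lemma tp_tsum u v N : tp N (tsum u v N).
Proof.
  apply (tp_sumZ N (fun m x => u m * cos (2 * PI * IZR m * x) + v m * sin (2 * PI * IZR m * x))).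
  intros m Hm. apply (tp_plus N (fun x => u m * cos (2 * PI * IZR m * x))); apply tp_scal;
    [now apply tp_cosine|now apply tp_sine].
Qed.

Lemma pri_cosine m : pri (fun x => cos (2 * PI * IZR m * x)).
Proof. apply (tp_pri (Z.abs_nat m)), tp_cosine. lia. Qed.

Lemma pri_sine m : pri (fun x => sin (2 * PI * IZR m * x)).
Proof. apply (tp_pri (Z.abs_nat m)), tp_sine. lia. Qed.

Lemma mean_cos_cos m k a b :
  mean (fun x => cos (2 * PI * IZR m * x + a) * cos (2 * PI * IZR k * x + b)) =
  / 2 * ((if Z.eqb m (- k) then cos (a + b) else 0) + (if Z.eqb m k then cos (a - b) else 0)).
Proof.
  rewrite (mean_ext _ (fun x => / 2 * (cos (2 * PI * IZR (m + k) * x + (a + b))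
                                     + cos (2 * PI * IZR (m - k) * x + (a - b))))).
  - assert (H := pri_cos (m + k) (a + b)). assert (H' := pri_cos (m - k) (a - b)).
    rewrite mean_scal, mean_plus, !mean_cos by pri. do 2 f_equal.
    + destruct (Z.eqb_spec (m + k) 0), (Z.eqb_spec m (- k)); auto; lia.
    + destruct (Z.eqb_spec (m - k) 0), (Z.eqb_spec m k); auto; lia.
  - intros x. rewrite minus_IZR, plus_IZR.
    replace (2 * PI * (IZR m - IZR k) * x + (a - b))
      with ((2 * PI * IZR m * x + a) - (2 * PI * IZR k * x + b)) by ring.
    replace (2 * PI * (IZR m + IZR k) * x + (a + b))
      with ((2 * PI * IZR m * x + a) + (2 * PI * IZR k * x + b)) by ring.
    generalize (2 * PI * IZR m * x + a) (2 * PI * IZR k * x + b); intros s t.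
    rewrite cos_minus, cos_plus. field.
Qed.

(** Only [m = k] and [m = -k] survive, and in real form these two frequencies cannot be told apart;
    hence the symmetrised coefficients. The free phase yields cosine and sine coefficients
    together. *)
Lemma tsum_coefficient u v N k th : (Z.abs k <= Z.of_nat N)%Z ->
  mean (fun x => tsum u v N x * cos (2 * PI * IZR k * x + th)) =
  / 2 * ((u (- k)%Z + u k) * cos th + (v (- k)%Z - v k) * sin th).
Proof.
  intros Hk. assert (Hp := pri_cos k th).
  rewrite (mean_ext _ (fun x => sumZ (fun m =>
    u m * (cos (2 * PI * IZR m * x + 0) * cos (2 * PI * IZR k * x + th)) +
    v m * (cos (2 * PI * IZR m * x + - (PI / 2)) * cos (2 * PI * IZR k * x + th))) N)).
  - assert (Hm : forall m a, pri (fun x => cos (2 * PI * IZR m * x + a) * cos (2 * PI * IZR k * x + th))).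
    { intros m a. assert (H := pri_cos m a). pri. }
    rewrite (mean_sumZ (fun m x =>
      u m * (cos (2 * PI * IZR m * x + 0) * cos (2 * PI * IZR k * x + th)) +
      v m * (cos (2 * PI * IZR m * x + - (PI / 2)) * cos (2 * PI * IZR k * x + th)))).
    2: { intros m. apply pri_plus; (apply pri_mult; [apply pri_const|apply Hm]). }
    rewrite (sumZ_ext _ (fun m =>
      / 2 * ((if Z.eqb m (- k) then u m * cos th + v m * sin th else 0) +
             (if Z.eqb m k then u m * cos th - v m * sin th else 0)))).
    + rewrite sumZ_scal, sumZ_plus.
      rewrite (sumZ_pick (fun m => u m * cos th + v m * sin th)) by lia.
      rewrite (sumZ_pick (fun m => u m * cos th - v m * sin th)) by lia. ring.
    + intros m. rewrite mean_plus.
      2, 3: apply pri_mult; [apply pri_const|apply Hm].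
      rewrite !mean_scal, !mean_cos_cos by apply Hm.
      rewrite Rplus_0_l. replace (0 - th) with (- th) by ring. rewrite cos_neg.
      replace (- (PI / 2) - th) with (- (PI / 2 + th)) by ring. rewrite cos_neg, (cos_plus (PI / 2) th), cos_PI2, sin_PI2.
      replace (- (PI / 2) + th) with (- (PI / 2 - th)) by ring. rewrite cos_neg, cos_shift.
      destruct (Z.eqb m (- k)), (Z.eqb m k); ring.
  - intros x. unfold tsum. rewrite Rmult_comm, <- sumZ_scal. apply sumZ_ext. intros m.
    rewrite Rplus_0_r, (cos_plus (2 * PI * IZR m * x) (- (PI / 2))), cos_neg, sin_neg, cos_PI2, sin_PI2.
    ring.
Qed.

Lemma ca_neg g m : ca g (- m) = ca g m.
Proof.
  apply mean_ext. intros x. rewrite opp_IZR, <- (cos_neg (2 * PI * IZR m * x)). do 2 f_equal. ring.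
Qed.

Lemma cb_neg g m : pri g -> cb g (- m) = - cb g m.
Proof.
  intros Hg. unfold cb. assert (H := pri_sine m).
  replace (- mean _) with (-1 * mean (fun x => g x * sin (2 * PI * IZR m * x))) by ring.
  rewrite <- mean_scal by pri. apply mean_ext. intros x. rewrite opp_IZR.
  replace (2 * PI * - IZR m * x) with (- (2 * PI * IZR m * x)) by ring. rewrite sin_neg. ring.
Qed.

Definition fsum (g : R -> R) (N : nat) : R -> R := tsum (ca g) (cb g) N.

(** Linearity reduces the claim to a single wave, where evenness of [ca] and oddness of [cb] undo
    the symmetrisation. *)
Lemma fsum_orthogonal g N Q : pri g -> tp N Q -> mean (fun x => (g x - fsum g N x) * Q x) = 0.
Proof.
  intros Hg HQ. assert (HS := tp_pri _ _ (tp_tsum (ca g) (cb g) N)). fold (fsum g N) in HS.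
  induction HQ as [k th Hk|P Q HP IHP HQ IHQ|c P HP IHP|P Q HE HP IHP].
  - assert (Hc := pri_cos k th). assert (Hc' := pri_cosine k). assert (Hs := pri_sine k).
    rewrite (mean_ext _ (fun x => (cos th * (g x * cos (2 * PI * IZR k * x)) -
      sin th * (g x * sin (2 * PI * IZR k * x))) - fsum g N x * cos (2 * PI * IZR k * x + th))).
    + rewrite !mean_minus, !mean_scal by pri. unfold fsum.
      rewrite tsum_coefficient, ca_neg, cb_neg by assumption.
      unfold ca, cb. field.
    + intros x. rewrite cos_plus. ring.
  - apply tp_pri in HP, HQ.
    rewrite (mean_ext _ (fun x => (g x - fsum g N x) * P x + (g x - fsum g N x) * Q x)) by (intros; ring).
    rewrite mean_plus, IHP, IHQ by pri. ring.
  - apply tp_pri in HP.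
    rewrite (mean_ext _ (fun x => c * ((g x - fsum g N x) * P x))) by (intros; ring).
    rewrite mean_scal, IHP by pri. ring.
  - rewrite <- IHP. apply mean_ext. intros x. now rewrite HE.
Qed.

Lemma fsum_best g N P : pri g -> tp N P ->
  mean (fun x => (g x - fsum g N x) * (g x - fsum g N x)) <= mean (fun x => (g x - P x) * (g x - P x)).
Proof.
  intros Hg HP. assert (HtS := tp_tsum (ca g) (cb g) N). fold (fsum g N) in HtS.
  assert (HS := tp_pri _ _ HtS). assert (HpP := tp_pri _ _ HP).
  rewrite (mean_ext (fun x => (g x - P x) * (g x - P x)) (fun x =>
    (g x - fsum g N x) * (g x - fsum g N x) +
    (2 * ((g x - fsum g N x) * (fsum g N x - P x)) + (fsum g N x - P x) * (fsum g N x - P x))))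
    by (intros; ring).
  rewrite mean_plus, mean_plus, mean_scal by pri.
  rewrite (fsum_orthogonal g N (fun x => fsum g N x - P x)) by (auto; now apply tp_minus).
  assert (0 <= mean (fun x => (fsum g N x - P x) * (fsum g N x - P x))); [|lra].
  apply mean_nonneg; [pri|]. intros x. apply Rle_0_sqr.
Qed.

(** By [fsum_best] it suffices to bound the squared error of the sandwich polynomial. Since [g] and
    [P] are both bounded by [B], that square is at most [2 * B * H]. *)
Lemma fsum_cv g : pri g -> forall eps, 0 < eps -> exists N0 : nat, forall N, (N0 <= N)%nat ->
  mean (fun x => (g x - fsum g N x) * (g x - fsum g N x)) <= eps.
Proof.
  intros Hg eps Heps. destruct (pri_bounded g Hg) as (B & HB0 & HB).
  destruct (trigonometric_sandwich g B (eps / (2 * B + 1)) Hg HB) as (D & P & H & HP & HH & HPB & HgP & Hm).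
  { apply Rdiv_lt_0_compat; lra. }
  exists D. intros N HN. apply (tp_mono _ N) in HP; [|exact HN].
  apply Rle_trans with (1 := fsum_best g N P Hg HP).
  apply tp_pri in HP, HH.
  apply Rle_trans with (mean (fun x => 2 * B * H x)).
  - apply mean_le; [pri..|]. intros x.
    replace ((g x - P x) * (g x - P x)) with (Rabs (g x - P x) * Rabs (g x - P x))
      by (rewrite <- Rabs_mult; apply Rabs_pos_eq, Rle_0_sqr).
    apply Rmult_le_compat; auto using Rabs_pos.
    eapply Rle_trans; [apply Rabs_triang|]. rewrite Rabs_Ropp. generalize (HB x) (HPB x). lra.
  - rewrite mean_scal by pri.
    apply Rle_trans with (2 * B * (eps / (2 * B + 1))); [apply Rmult_le_compat_l; lra|].
    apply Rmult_le_reg_r with (2 * B + 1); [lra|].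
    replace (2 * B * (eps / (2 * B + 1)) * (2 * B + 1)) with (2 * B * eps) by (field; lra). nra.
Qed.

(* Real and imaginary part of the product of the [m]-th Fourier coefficient of [g] with the
   conjugate of that of [h]. *)
Definition pc (g h : R -> R) (m : Z) : R := ca g m * ca h m + cb g m * cb h m.
Definition ps (g h : R -> R) (m : Z) : R := ca g m * cb h m - cb g m * ca h m.

(** The remainder of the expansion is exactly the correlation of the two Fourier errors, because the
    mixed terms vanish by orthogonality. This makes an estimate uniform in [s] possible. *)
Lemma corr_defect g h N s : pri g -> pri h ->
  corr g h s - tsum (pc g h) (fun m => - ps g h m) N s =
  mean (fun t => (g t - fsum g N t) * (h (t - s) - fsum h N (t - s))).
Proof.
  intros Hg Hh.
  assert (HtS := tp_tsum (ca g) (cb g) N). fold (fsum g N) in HtS.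
  assert (HtS' := tp_tsum (ca h) (cb h) N). fold (fsum h N) in HtS'.
  assert (HS := tp_pri _ _ HtS). assert (HS' := tp_pri _ _ HtS').
  rewrite (mean_ext _ (fun t => (g t * h (t - s) - g t * fsum h N (t - s)) -
    (h (t - s) - fsum h N (t - s)) * fsum g N t)) by (intros; ring).
  rewrite mean_minus, mean_minus by pri. fold (corr g h s).
  replace (mean (fun t => (h (t - s) - fsum h N (t - s)) * fsum g N t)) with 0.
  - rewrite Rminus_0_r. f_equal.
    rewrite (mean_ext _ (fun t => sumZ (fun m =>
      (ca h m * cos (2 * PI * IZR m * s) - cb h m * sin (2 * PI * IZR m * s)) * (g t * cos (2 * PI * IZR m * t)) +
      (ca h m * sin (2 * PI * IZR m * s) + cb h m * cos (2 * PI * IZR m * s)) * (g t * sin (2 * PI * IZR m * t))) N)).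
    + rewrite (mean_sumZ (fun m t =>
        (ca h m * cos (2 * PI * IZR m * s) - cb h m * sin (2 * PI * IZR m * s)) * (g t * cos (2 * PI * IZR m * t)) +
        (ca h m * sin (2 * PI * IZR m * s) + cb h m * cos (2 * PI * IZR m * s)) * (g t * sin (2 * PI * IZR m * t)))).
      * apply sumZ_ext. intros m. assert (Hc := pri_cosine m). assert (Hs := pri_sine m).
        rewrite mean_plus, !mean_scal by pri. fold (ca g m) (cb g m). unfold pc, ps. ring.
      * intros m. assert (Hc := pri_cosine m). assert (Hs := pri_sine m). pri.
    + intros t. unfold fsum, tsum. rewrite <- sumZ_scal. apply sumZ_ext. intros m.
      replace (2 * PI * IZR m * (t - s)) with (2 * PI * IZR m * t - 2 * PI * IZR m * s) by ring.
      rewrite cos_minus, sin_minus. ring.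
  (* After translation by [s] the error of [h] stands unshifted against a translate of [fsum g N],
     which still has degree at most [N]. *)
  - symmetry. rewrite <- (mean_shift _ s) by pri.
    rewrite <- (fsum_orthogonal h N (fun t => fsum g N (t - - s)) Hh (tp_shift _ _ _ HtS)).
    apply mean_ext. intros t. replace (t + s - s) with t by ring.
    now replace (t - - s) with (t + s) by ring.
Qed.

(** The inequality [|a b| <= (a^2 + b^2) / 2] separates the two errors, and translation invariance
    then removes [s]. *)
Lemma parseval g h : pri g -> pri h -> forall eps, 0 < eps ->
  exists N0 : nat, forall N s, (N0 <= N)%nat ->
    Rabs (corr g h s - tsum (pc g h) (fun m => - ps g h m) N s) <= eps.
Proof.
  intros Hg Hh eps Heps.
  destruct (fsum_cv g Hg eps Heps) as [N1 H1]. destruct (fsum_cv h Hh eps Heps) as [N2 H2].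
  exists (Nat.max N1 N2). intros N s HN.
  specialize (H1 N ltac:(lia)). specialize (H2 N ltac:(lia)).
  rewrite corr_defect by assumption.
  assert (HS := tp_pri _ _ (tp_tsum (ca g) (cb g) N)). fold (fsum g N) in HS.
  assert (HS' := tp_pri _ _ (tp_tsum (ca h) (cb h) N)). fold (fsum h N) in HS'.
  set (r := fun x => (h x - fsum h N x) * (h x - fsum h N x)) in H2.
  assert (Hr : pri r) by (unfold r; pri).
  apply Rle_trans with (mean (fun t => / 2 * ((g t - fsum g N t) * (g t - fsum g N t) + r (t - s)))).
  - apply mean_abs_le; [pri..|]. intros t. unfold r.
    set (a := g t - fsum g N t). set (b := h (t - s) - fsum h N (t - s)).
    apply Rabs_le. generalize (Rle_0_sqr (a - b)) (Rle_0_sqr (a + b)). unfold Rsqr. lra.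
  - rewrite mean_scal, mean_plus, mean_shift_minus by pri. lra.
Qed.

Lemma ps_diag g m : ps g g m = 0.
Proof. unfold ps. ring. Qed.

Lemma pc_diag_nonneg g m : 0 <= pc g g m.
Proof. unfold pc. apply Rplus_le_le_0_compat; apply Rle_0_sqr. Qed.

Lemma bessel g N : pri g -> sumZ (pc g g) N <= corr g g 0.
Proof.
  intros Hg. assert (H := corr_defect g g N 0 Hg Hg).
  replace (tsum (pc g g) (fun m => - ps g g m) N 0) with (sumZ (pc g g) N) in H.
  - assert (HS := tp_pri _ _ (tp_tsum (ca g) (cb g) N)). fold (fsum g N) in HS.
    enough (0 <= mean (fun t => (g t - fsum g N t) * (g (t - 0) - fsum g N (t - 0)))) by lra.
    apply mean_nonneg; [pri|]. intros t. rewrite Rminus_0_r. apply Rle_0_sqr.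
  - apply sumZ_ext. intros m. rewrite ps_diag, !Rmult_0_r, cos_0. ring.
Qed.

Lemma uniform_tp_pri K : (forall eps, 0 < eps -> exists D P, tp D P /\ forall x, Rabs (K x - P x) <= eps) ->
  pri K.
Proof.
  intros H. split.
  - intros x. apply cond_eq. intros e He. destruct (H (e / 3)) as (D & P & HP & HK); [lra|].
    apply tp_pri in HP. destruct HP as [HP _].
    replace (K (x + 1) - K x) with ((K (x + 1) - P (x + 1)) - (K x - P x)) by (rewrite HP; ring).
    eapply Rle_lt_trans; [apply Rabs_triang|]. rewrite Rabs_Ropp.
    generalize (HK (x + 1)) (HK x). lra.
  - apply (ex_RInt_continuous (V := R_CompleteNormedModule)). intros x _.
    apply continuity_pt_filterlim. intros e He.
    destruct (H (e / 4)) as (D & P & HP & HK); [lra|].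
    destruct (tp_lipschitz D P HP) as (L & HL & HPL).
    exists (e / (4 * (L + 1))). split; [apply Rdiv_lt_0_compat; lra|].
    intros y [_ Hy]. simpl in *. unfold Rdist in *.
    replace (K y - K x) with ((K y - P y) - (K x - P x) + (P y - P x)) by ring.
    eapply Rle_lt_trans; [apply Rabs_triang|].
    eapply Rle_lt_trans; [apply Rplus_le_compat_r, Rabs_triang|]. rewrite Rabs_Ropp.
    generalize (HK x) (HK y) (HPL y x). intros H1 H2 H3.
    assert (L * Rabs (y - x) <= e / 4).
    { apply Rle_trans with (L * (e / (4 * (L + 1)))); [apply Rmult_le_compat_l; lra|].
      apply Rmult_le_reg_r with (4 * (L + 1)); [lra|].
      replace (L * (e / (4 * (L + 1))) * (4 * (L + 1))) with (L * e) by (field; lra). nra. }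
    lra.
Qed.

(** Coefficients pass to a uniform limit. Applied to [conv_re] and [conv_im], this gives their
    integrability and their transform without interchanging two integrals. *)
Lemma uniform_coefficient K u v : (forall eps, 0 < eps -> exists N0 : nat, forall N s, (N0 <= N)%nat ->
    Rabs (K s - tsum u v N s) <= eps) ->
  pri K /\ (forall k, ca K k = / 2 * (u (- k)%Z + u k)) /\ (forall k, cb K k = / 2 * (v k - v (- k)%Z)).
Proof.
  intros H.
  assert (HK : pri K).
  { apply uniform_tp_pri. intros eps Heps. destruct (H eps Heps) as [N0 HN0].
    exists N0, (tsum u v N0). split; [apply tp_tsum|]. intros x. now apply HN0. }
  assert (Hth : forall k th, mean (fun x => K x * cos (2 * PI * IZR k * x + th)) =
    / 2 * ((u (- k)%Z + u k) * cos th + (v (- k)%Z - v k) * sin th)).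
  { intros k th. apply cond_eq. intros e He. destruct (H (e / 2)) as [N0 HN0]; [lra|].
    set (N := (N0 + Z.abs_nat k)%nat).
    rewrite <- (tsum_coefficient u v N k th) by lia.
    assert (Hc := pri_cos k th). assert (Ht := tp_pri _ _ (tp_tsum u v N)).
    rewrite <- mean_minus by pri.
    apply Rle_lt_trans with (mean (fun _ => e / 2)); [|rewrite mean_const; lra].
    apply mean_abs_le; [pri..|]. intros x. rewrite <- Rmult_minus_distr_r, Rabs_mult.
    rewrite <- (Rmult_1_r (e / 2)). apply Rmult_le_compat; auto using Rabs_pos.
    - apply HN0. lia.
    - apply Rabs_le, COS_bound. }
  split; [exact HK|]. split; intros k.
  - transitivity (mean (fun x => K x * cos (2 * PI * IZR k * x + 0))).
    + apply mean_ext. intros x. now rewrite Rplus_0_r.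
    + rewrite Hth, cos_0, sin_0. ring.
  - transitivity (mean (fun x => K x * cos (2 * PI * IZR k * x + - (PI / 2)))).
    + apply mean_ext. intros x. f_equal. rewrite cos_plus, cos_neg, sin_neg, cos_PI2, sin_PI2. ring.
    + rewrite Hth, cos_neg, sin_neg, cos_PI2, sin_PI2. ring.
Qed.

Lemma corr_swap g h s : pri g -> pri h -> corr g h (- s) = corr h g s.
Proof.
  intros Hg Hh. unfold corr. rewrite <- (mean_shift_minus (fun x => g x * h (x - - s)) s) by pri.
  apply mean_ext. intros x. replace (x - s - - s) with x by ring. ring.
Qed.

(** * Diffraction *)

(** The value chosen by [epsilon] is determined because all proofs of integrability give the same
    integral. Agreement on the open interval is enough, so endpoint values of [g] do not matter. *)
Lemma Rint_mean g G : pri G -> (forall x, 0 < x < 1 -> g x = G x) -> Rint g 0 1 = mean G.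
Proof.
  intros [_ HG] E.
  assert (Hg : ex_RInt g 0 1).
  { apply ex_RInt_ext with (2 := HG). intros x. rewrite Rmin_left, Rmax_right by lra.
    intros; symmetry; auto. }
  assert (HgG : RInt g 0 1 = mean G).
  { apply RInt_ext. intros x. rewrite Rmin_left, Rmax_right by lra. auto. }
  unfold Rint.
  destruct (epsilon_spec (inhabits 0) (fun v => Defs.is_RInt g 0 1 v)) as [pr Hpr].
  - exists (RInt g 0 1), (ex_RInt_Reals_0 _ _ _ Hg). symmetry. apply RInt_Reals.
  - rewrite <- Hpr, <- HgG. symmetry. apply RInt_Reals.
Qed.

Lemma frac_part_unit x : 0 <= x < 1 -> frac_part x = x.
Proof.
  intros Hx. unfold frac_part. rewrite <- (Int_part_spec x 0) by (simpl; lra). simpl. ring.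
Qed.

Lemma frac_part_succ x : frac_part (x + 1) = frac_part x.
Proof.
  unfold frac_part. destruct (base_Int_part x).
  rewrite <- (Int_part_spec (x + 1) (Int_part x + 1)); rewrite plus_IZR; lra.
Qed.

Lemma pri_periodization f : Riemann_integrable f 0 1 -> pri (fun x => f (frac_part x)).
Proof.
  intros Hf. split.
  - intros x. f_equal. apply frac_part_succ.
  - apply ex_RInt_ext with f; [|now apply ex_RInt_Reals_1].
    intros x. rewrite Rmin_left, Rmax_right by lra. intros Hx. f_equal.
    symmetry. apply frac_part_unit. lra.
Qed.

Lemma Xi_corr f alpha z : Riemann_integrable f 0 1 ->
  Xi f alpha z = corr (fun x => f (frac_part x)) (fun x => f (frac_part x)) (IZR z * alpha).
Proof.
  intros Hf. assert (HF := pri_periodization f Hf). set (F := fun x => f (frac_part x)) in *.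
  unfold Xi, corr. apply Rint_mean; [pri|]. intros x Hx. rewrite Rmult_comm. f_equal.
  - unfold F. now rewrite frac_part_unit by lra.
  - unfold F, rot. do 2 f_equal. rewrite opp_IZR. ring.
Qed.

Lemma fhat_sqnorm_pc f m : Riemann_integrable f 0 1 ->
  fhat_sqnorm f m = pc (fun x => f (frac_part x)) (fun x => f (frac_part x)) m.
Proof.
  intros Hf. assert (HF := pri_periodization f Hf). set (F := fun x => f (frac_part x)) in *.
  assert (Hc := pri_cosine m). assert (Hs := pri_sine m).
  assert (E : forall x, 0 < x < 1 -> f x = F x).
  { intros x Hx. unfold F. now rewrite frac_part_unit by lra. }
  unfold fhat_sqnorm, fhat_re, fhat_im, pc, ca, cb.
  rewrite (Rint_mean _ (fun x => F x * cos (2 * PI * IZR m * x))); [|pri|intros; now rewrite E].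
  rewrite (Rint_mean _ (fun x => F x * sin (2 * PI * IZR m * x))); [|pri|intros; now rewrite E].
  ring.
Qed.

Lemma circle_cont_pri lr li : circle_cont lr li -> pri lr /\ pri li.
Proof.
  intros (Hr & Hi & Hp).
  assert (C : forall l, continuity l -> ex_RInt l 0 1).
  { intros l Hl. apply (ex_RInt_continuous (V := R_CompleteNormedModule)). intros x _.
    apply continuity_pt_filterlim, Hl. }
  split; (split; [intros x; apply Hp|now apply C]).
Qed.

Lemma conv_re_corr lr li s : pri lr -> pri li ->
  conv_re lr li s = corr lr lr s + corr li li s.
Proof.
  intros Hr Hi. unfold conv_re, corr. rewrite <- mean_plus by pri. apply Rint_mean; [pri|reflexivity].
Qed.

Lemma conv_im_corr lr li s : pri lr -> pri li ->
  conv_im lr li s = corr li lr s - corr lr li s.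
Proof.
  intros Hr Hi. unfold conv_im, corr. rewrite <- mean_minus by pri. apply Rint_mean; [pri|reflexivity].
Qed.

Lemma conv_re_fourier lr li : pri lr -> pri li -> forall eps, 0 < eps ->
  exists N0 : nat, forall N s, (N0 <= N)%nat ->
  Rabs (conv_re lr li s - tsum (fun m => pc lr lr m + pc li li m) (fun _ => 0) N s) <= eps.
Proof.
  intros Hr Hi eps He. destruct (parseval lr lr Hr Hr (eps / 2)) as [N1 H1]; [lra|].
  destruct (parseval li li Hi Hi (eps / 2)) as [N2 H2]; [lra|].
  exists (Nat.max N1 N2). intros N s HN.
  specialize (H1 N s ltac:(lia)). specialize (H2 N s ltac:(lia)).
  rewrite conv_re_corr by assumption.
  replace (tsum (fun m => pc lr lr m + pc li li m) (fun _ => 0) N s) with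
    (tsum (pc lr lr) (fun m => - ps lr lr m) N s + tsum (pc li li) (fun m => - ps li li m) N s).
  - apply Rabs_le_between in H1, H2. apply Rabs_le. lra.
  - unfold tsum. rewrite <- sumZ_plus. apply sumZ_ext. intros m. rewrite !ps_diag. ring.
Qed.

(** [pc] is symmetric and [ps] antisymmetric in the two functions, so in the difference of
    correlations the cosine terms cancel and the sine terms double. *)
Lemma conv_im_fourier lr li : pri lr -> pri li -> forall eps, 0 < eps ->
  exists N0 : nat, forall N s, (N0 <= N)%nat ->
  Rabs (conv_im lr li s - tsum (fun _ => 0) (fun m => 2 * ps lr li m) N s) <= eps.
Proof.
  intros Hr Hi eps He. destruct (parseval li lr Hi Hr (eps / 2)) as [N1 H1]; [lra|].
  destruct (parseval lr li Hr Hi (eps / 2)) as [N2 H2]; [lra|].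
  exists (Nat.max N1 N2). intros N s HN.
  specialize (H1 N s ltac:(lia)). specialize (H2 N s ltac:(lia)).
  rewrite conv_im_corr by assumption.
  replace (tsum (fun _ => 0) (fun m => 2 * ps lr li m) N s) with
    (tsum (pc li lr) (fun m => - ps li lr m) N s - tsum (pc lr li) (fun m => - ps lr li m) N s).
  - apply Rabs_le_between in H1, H2. apply Rabs_le. lra.
  - unfold tsum. rewrite <- sumZ_minus. apply sumZ_ext. intros m. unfold pc, ps. ring.
Qed.

Lemma pc_neg g h m : pri g -> pri h -> pc g h (- m) = pc g h m.
Proof. intros Hg Hh. unfold pc. rewrite !ca_neg, !cb_neg by assumption. ring. Qed.

Lemma ps_neg g h m : pri g -> pri h -> ps g h (- m) = - ps g h m.
Proof. intros Hg Hh. unfold ps. rewrite !ca_neg, !cb_neg by assumption. ring. Qed.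

Lemma conv_pri lr li : pri lr -> pri li -> pri (conv_re lr li) /\ pri (conv_im lr li).
Proof.
  intros Hr Hi.
  split; eapply uniform_coefficient; [now apply conv_re_fourier|now apply conv_im_fourier].
Qed.

(* The right-hand side is [|l^(z)|^2]; its part odd in [z] is [2 * ps lr li z]. *)
Lemma convhat_re_eq lr li z : pri lr -> pri li ->
  convhat_re lr li z = pc lr lr z + pc li li z + 2 * ps lr li z.
Proof.
  intros Hr Hi. destruct (conv_pri lr li Hr Hi) as [HK1 HK2]. assert (Hc := pri_cosine z). assert (Hs := pri_sine z).
  destruct (uniform_coefficient _ _ _ (conv_re_fourier lr li Hr Hi)) as (_ & H1 & _).
  destruct (uniform_coefficient _ _ _ (conv_im_fourier lr li Hr Hi)) as (_ & _ & H2).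
  transitivity (ca (conv_re lr li) z + cb (conv_im lr li) z).
  - unfold ca, cb. rewrite <- mean_plus by pri. apply Rint_mean; [pri|reflexivity].
  - rewrite H1, H2, !pc_neg, ps_neg by assumption. field.
Qed.

(** The value is the sum of the squares of [ca lr z + cb li z] and [ca li z - cb lr z], the real and
    imaginary parts of the coefficient of [l]. *)
Lemma convhat_re_nonneg lr li z : pri lr -> pri li -> 0 <= convhat_re lr li z.
Proof.
  intros Hr Hi. rewrite convhat_re_eq by assumption. unfold pc, ps.
  generalize (Rle_0_sqr (ca lr z + cb li z)) (Rle_0_sqr (ca li z - cb lr z)). unfold Rsqr. lra.
Qed.

Lemma convhat_im_zero lr li z : pri lr -> pri li -> convhat_im lr li z = 0.
Proof.
  intros Hr Hi. destruct (conv_pri lr li Hr Hi) as [HK1 HK2]. assert (Hc := pri_cosine z). assert (Hs := pri_sine z).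
  destruct (uniform_coefficient _ _ _ (conv_re_fourier lr li Hr Hi)) as (_ & _ & H1).
  destruct (uniform_coefficient _ _ _ (conv_im_fourier lr li Hr Hi)) as (_ & H2 & _).
  transitivity (ca (conv_im lr li) z - cb (conv_re lr li) z).
  - unfold ca, cb. rewrite <- mean_minus by pri. apply Rint_mean; [pri|reflexivity].
  - rewrite H1, H2. ring.
Qed.

Lemma conv_im_odd lr li s : pri lr -> pri li -> conv_im lr li (- s) = - conv_im lr li s.
Proof. intros Hr Hi. rewrite !conv_im_corr, !corr_swap by assumption. ring. Qed.

(** Against an even sequence the odd part [2 * ps lr li z] cancels. What remains are the cosine
    coefficients of [conv_re], the form needed for the duality with [Xi]. *)
Lemma sumZ_convhat_even lr li h N : pri lr -> pri li -> (forall z, h (- z)%Z = h z) ->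
  sumZ (fun z => convhat_re lr li z * h z) N = sumZ (fun z => (pc lr lr z + pc li li z) * h z) N.
Proof.
  intros Hr Hi Hh. rewrite (sumZ_ext _ (fun z => (pc lr lr z + pc li li z) * h z + 2 * ps lr li z * h z)).
  - rewrite sumZ_plus, (sumZ_odd (fun z => 2 * ps lr li z * h z)); [ring|].
    intros z. rewrite Hh, ps_neg by assumption. ring.
  - intros z. rewrite convhat_re_eq by assumption. ring.
Qed.

(** The kernel [cos (2 pi z m alpha)] is symmetric in [z] and [m], so finite double sums may be read
    in either order. *)
Lemma tsum_exchange u c alpha N :
  sumZ (fun z => u z * tsum c (fun _ => 0) N (IZR z * alpha)) N =
  sumZ (fun m => c m * tsum u (fun _ => 0) N (alpha * IZR m)) N.
Proof.
  rewrite (sumZ_ext _ (fun z => sumZ (fun m => u z * c m * cos (2 * PI * IZR m * (IZR z * alpha))) N)).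
  - rewrite sumZ_swap. apply sumZ_ext. intros m. unfold tsum. rewrite <- sumZ_scal.
    apply sumZ_ext. intros z.
    replace (2 * PI * IZR z * (alpha * IZR m)) with (2 * PI * IZR m * (IZR z * alpha)) by ring. ring.
  - intros z. unfold tsum. rewrite <- sumZ_scal. apply sumZ_ext. intros m. ring.
Qed.

(* Both sums are close to the double sum of [u(z) c(m) exp(2 pi i z m alpha)]. *)
Lemma fourier_duality u c phi psi alpha Bu Bc :
  (forall z, 0 <= u z) -> (forall m, 0 <= c m) ->
  (forall N, sumZ u N <= Bu) -> (forall N, sumZ c N <= Bc) ->
  (forall eps, 0 < eps -> exists N0 : nat, forall N s, (N0 <= N)%nat ->
     Rabs (phi s - tsum u (fun _ => 0) N s) <= eps) ->
  (forall eps, 0 < eps -> exists N0 : nat, forall N s, (N0 <= N)%nat ->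
     Rabs (psi s - tsum c (fun _ => 0) N s) <= eps) ->
  Un_cv (fun N => sumZ (fun z => u z * psi (IZR z * alpha)) N -
                  sumZ (fun m => c m * phi (alpha * IZR m)) N) 0.
Proof.
  intros Hu Hc HBu HBc Hphi Hpsi e He.
  assert (HBu0 : 0 <= Bu).
  { apply Rle_trans with (2 := HBu 0%nat). unfold sumZ; simpl. apply Hu. }
  assert (HBc0 : 0 <= Bc).
  { apply Rle_trans with (2 := HBc 0%nat). unfold sumZ; simpl. apply Hc. }
  set (d := e / (2 * (Bu + Bc + 1))).
  assert (Hd : 0 < d) by (unfold d; apply Rdiv_lt_0_compat; lra).
  destruct (Hphi d Hd) as [N1 H1]. destruct (Hpsi d Hd) as [N2 H2].
  exists (Nat.max N1 N2). intros N HN. unfold Rdist. rewrite Rminus_0_r.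
  set (X := sumZ (fun z => u z * tsum c (fun _ => 0) N (IZR z * alpha)) N).
  assert (A : forall a p q B, (forall m, 0 <= a m) -> sumZ a N <= B ->
    (forall m, Rabs (p m - q m) <= d) ->
    Rabs (sumZ (fun m => a m * p m) N - sumZ (fun m => a m * q m) N) <= d * B).
  { intros a p q B Ha HB Hpq. rewrite <- sumZ_minus. eapply Rle_trans; [apply sumZ_abs|].
    apply Rle_trans with (sumZ (fun m => d * a m) N).
    - apply sumZ_le. intros m. rewrite <- Rmult_minus_distr_l, Rabs_mult, (Rabs_pos_eq (a m)) by auto.
      rewrite Rmult_comm. apply Rmult_le_compat_r; auto.
    - rewrite sumZ_scal. apply Rmult_le_compat_l; lra. }
  assert (A1 := A u (fun z => psi (IZR z * alpha)) (fun z => tsum c (fun _ => 0) N (IZR z * alpha)) Bu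
    Hu (HBu N) (fun m => H2 N _ ltac:(lia))).
  assert (A2 := A c (fun m => phi (alpha * IZR m)) (fun m => tsum u (fun _ => 0) N (alpha * IZR m)) Bc
    Hc (HBc N) (fun m => H1 N _ ltac:(lia))).
  cbv beta in A1, A2. rewrite <- tsum_exchange in A2. fold X in A1, A2.
  apply Rabs_le_between in A1, A2.
  assert (Hde : d * Bu + d * Bc < e).
  { assert (d * (2 * (Bu + Bc + 1)) = e) by (unfold d; field; lra). nra. }
  apply Rabs_lt_between. lra.
Qed.

Lemma rotation_diffraction f alpha : Riemann_integrable f 0 1 ->
  is_pp_diffraction (Xi f alpha) (fhat_sqnorm f) (fun m => alpha * IZR m).
Proof.
  intros Hf. assert (HF := pri_periodization f Hf).
  assert (HXi := fun z => Xi_corr f alpha z Hf). assert (Hfh := fun m => fhat_sqnorm_pc f m Hf).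
  set (F := fun x => f (frac_part x)) in *.
  destruct (pri_bounded F HF) as (B & HB0 & HB).
  assert (HXiB : forall z, Rabs (Xi f alpha z) <= B * B).
  { intros z. rewrite HXi, <- (mean_const (B * B)). unfold corr.
    apply mean_abs_le; [pri..|]. intros x. rewrite Rabs_mult.
    apply Rmult_le_compat; auto using Rabs_pos. }
  assert (Hc0 : forall m, 0 <= fhat_sqnorm f m) by (intros; rewrite Hfh; apply pc_diag_nonneg).
  assert (HcB : forall N, sumZ (fhat_sqnorm f) N <= corr F F 0).
  { intros N. rewrite (sumZ_ext _ (pc F F)) by exact Hfh. now apply bessel. }
  split; [now exists (B * B)|]. split; [exact Hc0|]. split; [now exists (corr F F 0)|].
  intros lr li Hl. apply circle_cont_pri in Hl. destruct Hl as [Hr Hi].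
  set (u := fun m => pc lr lr m + pc li li m).
  assert (HuB : forall N, sumZ u N <= corr lr lr 0 + corr li li 0).
  { intros N. unfold u. rewrite sumZ_plus. generalize (bessel lr N Hr) (bessel li N Hi). lra. }
  assert (Hu0 : forall m, 0 <= u m).
  { intros m. unfold u. generalize (pc_diag_nonneg lr m) (pc_diag_nonneg li m). lra. }
  assert (Habs : forall N, sumZ (fun z => Rabs (convhat_re lr li z * Xi f alpha z)) N <=
    (corr lr lr 0 + corr li li 0) * (B * B)).
  { intros N. apply Rle_trans with (sumZ (fun z => B * B * (convhat_re lr li z * 1)) N).
    - apply sumZ_le. intros z. rewrite Rmult_1_r, Rabs_mult, Rabs_pos_eq, Rmult_comm
        by now apply convhat_re_nonneg.
      apply Rmult_le_compat_r; [now apply convhat_re_nonneg|auto].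
    - rewrite sumZ_scal, Rmult_comm. apply Rmult_le_compat_r; [nra|].
      rewrite (sumZ_convhat_even lr li (fun _ => 1) N Hr Hi) by reflexivity.
      rewrite (sumZ_ext _ u); [apply HuB|]. intros; unfold u; ring. }
  split.
  - exists ((corr lr lr 0 + corr li li 0) * (B * B)). intros N.
    apply Rle_trans with (2 := Habs N). right. apply sumZ_ext. intros z.
    rewrite convhat_im_zero, Rabs_R0, Rplus_0_r by assumption. symmetry. apply Rabs_mult.
  (* The real limit comes from absolute convergence on the [Z] side and is carried to the circle
     side by duality. The imaginary limit is 0: termwise on the [Z] side, by oddness of [conv_im] on
     the circle side. *)
  - destruct (sumZ_abs_cv _ _ Habs) as [L HL]. exists L, 0.
    assert (Hzero : forall v : Z -> R, (forall N, sumZ v N = 0) -> Un_cv (sumZ v) 0).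
    { intros v Hv e He. exists 0%nat. intros n _. unfold Rdist.
      now rewrite Hv, Rminus_0_r, Rabs_R0. }
    split; [exact HL|]. split; [|split].
    + apply Hzero. intros N. rewrite (sumZ_ext _ (fun _ => 0)); [apply sumZ_odd; intros; ring|].
      intros z. rewrite convhat_im_zero by assumption. ring.
    + assert (Hdual : Un_cv (fun N => sumZ (fun z => u z * corr F F (IZR z * alpha)) N -
        sumZ (fun m => fhat_sqnorm f m * conv_re lr li (alpha * IZR m)) N) 0).
      { apply (fourier_duality u (fhat_sqnorm f) (conv_re lr li) (corr F F) alpha _ _ Hu0 Hc0 HuB HcB).
        - intros eps Heps. now apply conv_re_fourier.
        - intros eps Heps. destruct (parseval F F HF HF eps Heps) as [N0 HN0]. exists N0. intros N s HN.
          replace (tsum (fhat_sqnorm f) (fun _ => 0) N s) with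
            (tsum (pc F F) (fun m => - ps F F m) N s); [now apply HN0|].
          apply sumZ_ext. intros m. rewrite Hfh, ps_diag. ring. }
      intros e He. destruct (HL (e / 2)) as [N1 HN1]; [lra|]. destruct (Hdual (e / 2)) as [N2 HN2]; [lra|].
      exists (Nat.max N1 N2). intros N HN. specialize (HN1 N ltac:(lia)). specialize (HN2 N ltac:(lia)).
      unfold Rdist in *. rewrite (sumZ_convhat_even lr li (Xi f alpha) N Hr Hi) in HN1.
      * rewrite (sumZ_ext (fun z => (pc lr lr z + pc li li z) * Xi f alpha z)
          (fun z => u z * corr F F (IZR z * alpha))) in HN1 by (intros; now rewrite HXi).
        apply Rabs_lt_between in HN1, HN2. apply Rabs_lt_between. lra.
      * intros z. rewrite !HXi, opp_IZR, <- Ropp_mult_distr_l. now apply corr_swap.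
    + apply Hzero. intros N. apply sumZ_odd. intros m.
      replace (fhat_sqnorm f (- m)) with (fhat_sqnorm f m) by (rewrite !Hfh; symmetry; now apply pc_neg).
      rewrite opp_IZR, <- Ropp_mult_distr_r, conv_im_odd by assumption. ring.
Qed.

Theorem theorem4p4 (f : R -> R) (alpha : R) (fs : nat -> R -> R)
  (alphas : nat -> R) (ys : nat -> R) :
  Riemann_integrable f 0 1 ->
  (forall x, 0 <= x < 1 -> 0 <= f x) ->
  0 < alpha ->
  (forall i, Riemann_integrable (fs i) 0 1) ->
  (forall i x, 0 <= x < 1 -> 0 <= fs i x) ->
  (forall eps, 0 < eps -> exists N : nat, forall (i : nat) (x : R),
      (N <= i)%nat -> 0 <= x < 1 -> Rabs (fs i x - f x) < eps) ->
  (forall i, 0 < alphas i) ->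
  Un_cv alphas alpha ->
  (forall i, alphas i <> alpha) ->
  (forall i, 0 <= ys i < 1) ->
  exists gams : nat -> Z -> R,
    (forall i, is_autocorrelation (return_weights (fs i) (alphas i) (ys i)) (gams i)) /\
    vague_cv gams (Xi f alpha) /\
    is_pp_diffraction (Xi f alpha) (fhat_sqnorm f) (fun m => alpha * IZR m).
Proof.
  intros Hf _ _ Hfs _ Hunif _ Hcv Hne _.
  assert (HF := pri_periodization f Hf).
  assert (Hg : forall i z, {l | Un_cv (fun n =>
    autocorr_approx (return_weights (fs i) (alphas i) (ys i)) n z) l}).
  { intros i z. apply constructive_indefinite_description.
    exact (autocorrelation_exists _ (alphas i) (ys i) z (pri_periodization _ (Hfs i))). }
  exists (fun i z => proj1_sig (Hg i z)). split; [|split].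
  - intros i z. exact (proj2_sig (Hg i z)).
  - intros z e He. rewrite Xi_corr by assumption.
    destruct (pri_bounded _ HF) as (B & _ & HB).
    (* The resulting [D] and [d] set three thresholds for [i]: uniform closeness of the weights,
       non-resonance up to [D], and closeness of [z * alphas i] to [z * alpha]. *)
    destruct (autocorr_near _ B z HF HB (e / 3)) as (D & d & Hd & Hnear); [lra|].
    destruct (Hunif d Hd) as [N1 HN1].
    destruct (eventually_nonresonant alphas alpha Hcv Hne D) as [N2 HN2].
    destruct (Hcv (d / (Rabs (IZR z) + 1))) as [N3 HN3].
    { apply Rdiv_lt_0_compat; [exact Hd|]. generalize (Rabs_pos (IZR z)). lra. }
    exists (Nat.max N1 (Nat.max N2 N3)). intros i Hi.
    destruct (Hnear (fun x => fs i (frac_part x)) (alphas i) (IZR z * alpha) (ys i)) as [N HN].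
    + intros x. left. apply HN1; [lia|]. destruct (base_fp x); lra.
    + apply HN2. lia.
    + rewrite <- Rmult_minus_distr_l, Rabs_mult.
      specialize (HN3 i ltac:(lia)). unfold Rdist in HN3. generalize (Rabs_pos (IZR z)); intros Hz.
      apply (Rmult_lt_compat_r (Rabs (IZR z) + 1)) in HN3; [|lra].
      replace (d / (Rabs (IZR z) + 1) * (Rabs (IZR z) + 1)) with d in HN3 by (field; lra).
      generalize (Rabs_pos (alphas i - alpha)). nra.
    (* For this fixed [i], a single [n] past both thresholds places the approximant near the
       autocorrelation and near the correlation of [f]. *)
    + destruct (proj2_sig (Hg i z) (e / 3)) as [M HM]; [lra|].
      specialize (HM (Nat.max N M) ltac:(lia)). specialize (HN (Nat.max N M) ltac:(lia)).
      set (A := autocorr_approx _ _ _) in HN.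
      change (Rabs (A - proj1_sig (Hg i z)) < e / 3) in HM. unfold Rdist.
      apply Rabs_le_between in HN. apply Rabs_lt_between in HM. apply Rabs_lt_between. lra.
  - now apply rotation_diffraction.
Qed.
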